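(* Let $K$ be an algebraically closed field of characteristic $p>0$, let $G$ be a cyclic group of order $p$ with generator $\sigma$, and let $V=\bigoplus_{j=1}^{l}V_{n_j}$ be a $G$-module over $K$ with $l\ge 1$ and $1<n_j\le p$ for all $j$, where $V_n$ is the indecomposable $G$-module of dimension $n$. Let $x_{i,j}$ ($1\le i\le n_j$, $1\le j\le l$) be the variables of $K[V]$ with $\sigma(x_{1,j})=x_{1,j}$ and $\sigma(x_{i,j})=x_{i,j}+x_{i-1,j}$ for $1<i\le n_j$. Let $I^{G}$ be the transfer ideal of $K[V]^{G}$. Then the algebra $K[V]^{G}/I^{G}$ is Cohen-Macaulay, and a homogeneous system of parameters of it is given by the set $\{N(x_{n_j,j})+I^{G}\mid 1\le j\le l\}$. In particular, $\operatorname{depth}(I^{G})=l+1$, where $I^G$ is considered as a $K[V]^G$-module.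
   Context: $V_n$ (for $1\le n\le p$) is the $G$-module on which $\sigma$ acts by a single Jordan block of size $n$ with $1$'s on the diagonal. $K[V]:=S(V^{*})=K[x_{i,j}\mid 1\le i\le n_j,\ 1\le j\le l]$ is the polynomial ring with its standard grading, with $G$ acting by graded $K$-algebra automorphisms as specified in the claim, and $K[V]^{G}$ is the graded subalgebra of invariants. For $f\in K[V]$, the norm is $N(f)=\prod_{\tau\in G}\tau(f)$. The transfer map is $\operatorname{Tr}:K[V]\to K[V]^{G}$, $\operatorname{Tr}(f)=\sum_{i=0}^{p-1}\sigma^{i}(f)$, and the transfer ideal is its image $I^{G}=\operatorname{Tr}(K[V])$, a homogeneous ideal of $K[V]^{G}$. For a graded affine (finitely generated) $K$-algebra $R=\bigoplus_{d\ge 0}R_d$ with $R_0=K$, put $R_+=\bigoplus_{d\ge1}R_d$. A homogeneous system of parameters of $R$ is a set of algebraically independent homogeneous elements $a_1,\dots,a_n\in R$ such that $R$ is finitely generated as a module over $K[a_1,\dots,a_n]$. For a finitely generated graded nonzero $R$-module $M$, a sequence of homogeneous elements $a_1,\dots,a_k\in R_+$ is $M$-regular if each $a_i$ is a nonzero divisor on $M/(a_1,\dots,a_{i-1})M$; $\operatorname{depth}(M)$ is the maximal length of an $M$-regular sequence in $R_+$, $\dim(M)$ is the Krull dimension of $R/\operatorname{Ann}_R(M)$, and $M$ is Cohen-Macaulay if $\operatorname{depth}(M)=\dim(M)$. The ring $R$ is Cohen-Macaulay if it is so as a module over itself. *)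

(* Defs.v *)
From HB Require Import structures.
From mathcomp Require Import all_boot all_order all_algebra all_fingroup.
From mathcomp Require Import boolp.
From mathcomp.multinomials Require Import mpoly.

Set Implicit Arguments.
Unset Strict Implicit.
Unset Printing Implicit Defensive.

Import GRing.Theory.

Local Open Scope ring_scope.
Local Open Scope quotient_scope.

(* The library equips the quotient of a commutative ring by a (proper) ideal
   with a ring structure only; here it inherits a K-algebra structure. *)
Section QuotientAlgebra.

Variables (K : comNzRingType) (R : comAlgType K) (I : idealr R).

Let Q := {ideal_quot I}.

Definition quot_scale (c : K) (q : Q) : Q := \pi_Q (c%:A) * q.

Fact quot_scaleA a b q : quot_scale a (quot_scale b q) = quot_scale (a * b) q.
Proof. by rewrite /quot_scale mulrA -rmorphM /= -scalerAl mul1r scalerA. Qed.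

Fact quot_scale1 : left_id 1 quot_scale.
Proof. by move=> q; rewrite /quot_scale scale1r rmorph1 mul1r. Qed.

Fact quot_scaleDr : right_distributive quot_scale +%R.
Proof. by move=> a u v; rewrite /quot_scale mulrDr. Qed.

Fact quot_scaleDl q : {morph quot_scale^~ q : a b / a + b}.
Proof. by move=> a b; rewrite /quot_scale scalerDl rmorphD mulrDl. Qed.

HB.instance Definition _ := GRing.Zmodule_isLmodule.Build K (Quotient.quot I)
  quot_scaleA quot_scale1 quot_scaleDr quot_scaleDl.

Fact quot_scaleAl (a : K) (u v : Q) : a *: (u * v) = (a *: u) * v.
Proof. by rewrite /GRing.scale /= /quot_scale mulrA. Qed.

HB.instance Definition _ :=
  GRing.Lmodule_isLalgebra.Build K (Quotient.quot I) quot_scaleAl.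
HB.instance Definition _ :=
  GRing.Lalgebra_isComAlgebra.Build K (Quotient.quot I).

End QuotientAlgebra.

Section IdealModule.

Variables (R : comNzRingType) (I : idealr R).

Record ideal_module := IdealModule { ideal_val :> R^o; _ : ideal_val \in I }.

HB.instance Definition _ := [isSub for ideal_val].
HB.instance Definition _ := [Choice of ideal_module by <:].

Fact ideal_subsemimod_closed : subsemimod_closed (I : {pred R^o}).
Proof.
split; last by move=> a u uI; exact: idealMr.
by split=> [|u v]; [exact: rpred0 | exact: rpredD].
Qed.

HB.instance Definition _ := GRing.SubChoice_isSubLmodule.Build
  R R^o I ideal_module ideal_subsemimod_closed.

End IdealModule.

(* The proof of non-triviality is only used to know that the annihilator is a
   proper ideal. *)
Section Annihilator.

Variables (R : comNzRingType) (M : lmodType R) (Mneq0 : exists m : M, m != 0).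

Definition annihilator (_ : exists m : M, m != 0) : {pred R} :=
  fun a => `[< forall m : M, a *: m = 0 >].

Fact annihilator_idealr_closed : idealr_closed (annihilator Mneq0).
Proof.
split=> [||a u v /asboolP u0 /asboolP v0].
- by apply/asboolP => m; rewrite scale0r.
- have [m /eqP m0] := Mneq0; apply/asboolP => ann1.
  by apply: m0; rewrite -[m]scale1r ann1.
- by apply/asboolP => m; rewrite scalerDl -scalerA u0 v0 scaler0 addr0.
Qed.

HB.instance Definition _ :=
  isIdealr.Build R (annihilator Mneq0) annihilator_idealr_closed.

End Annihilator.

Section KrullDimension.

Variable A : comNzRingType.

Definition prime_ideal (P : {pred A}) : Prop :=
  idealr_closed P /\ prime_idealr_closed P.

Definition prime_chain (d : nat) (P : 'I_d.+1 -> {pred A}) : Prop :=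
  (forall i, prime_ideal (P i)) /\
  (forall i j : 'I_d.+1, (i < j)%N ->
     {subset P i <= P j} /\ ~ {subset P j <= P i}).

Definition is_krull_dim (d : nat) : Prop :=
  (exists P : 'I_d.+1 -> {pred A}, prime_chain P) /\
  (forall (e : nat) (P : 'I_e.+1 -> {pred A}), prime_chain P -> (e <= d)%N).

End KrullDimension.

Definition is_module_dim (R : comNzRingType) (M : lmodType R) (d : nat) : Prop :=
  exists Mneq0 : exists m : M, m != 0,
    is_krull_dim {ideal_quot (annihilator Mneq0)} d.

(* A grading of R is given by its family of homogeneous components:
   [deg d a] means that a lies in R_d. *)
Section Depth.

Variables (R : comNzRingType) (deg : nat -> R -> Prop) (M : lmodType R).

(* m lies in (a_1, ..., a_i) M, the indices of a starting at 0. *)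
Definition in_initial_submod k (a : 'I_k -> R) (i : nat) (m : M) : Prop :=
  exists c : 'I_k -> M, m = \sum_(j < k | (j < i)%N) a j *: c j.

(* The second clause says that the class of a_i is a nonzero divisor on
   M / (a_1, ..., a_(i-1)) M. *)
Definition regular_seq k (a : 'I_k -> R) : Prop :=
  (forall i, exists2 d, (0 < d)%N & deg d (a i)) /\
  (forall (i : 'I_k) (m : M),
     in_initial_submod a i (a i *: m) -> in_initial_submod a i m).

Definition is_depth (d : nat) : Prop :=
  (exists a : 'I_d -> R, regular_seq a) /\
  (forall (k : nat) (a : 'I_k -> R), regular_seq a -> (k <= d)%N).

Definition cohen_macaulay_module : Prop :=
  exists d, is_depth d /\ is_module_dim M d.

End Depth.

Definition cohen_macaulay (R : comNzRingType) (deg : nat -> R -> Prop) : Prop :=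
  cohen_macaulay_module deg R^o.

Section SystemOfParameters.

Variables (K : fieldType) (R : comAlgType K) (deg : nat -> R -> Prop).
Variables (k : nat) (a : 'I_k -> R).

Let eval_at : {mpoly K[k]} -> R := mmap (in_alg R) a.

Definition algebraically_independent : Prop :=
  forall q : {mpoly K[k]}, eval_at q = 0 -> q = 0.

Definition finite_over_generated_subalgebra : Prop :=
  exists (m : nat) (b : 'I_m -> R), forall r : R,
    exists c : 'I_m -> {mpoly K[k]}, r = \sum_(i < m) eval_at (c i) * b i.

Definition hsop : Prop :=
  [/\ forall i, exists d, deg d (a i),
      algebraically_independent & finite_over_generated_subalgebra].

End SystemOfParameters.

(* The variables are indexed by the pairs (j, i) with i < n_j; both indices
   start at 0, so that [xvar K i] for i : 'I_(n j) is x_(i+1,j+1). *)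
Section JordanAction.

Variables (K : fieldType) (l : nat) (n : 'I_l -> nat).

Definition num_vars : nat := #|{: {j : 'I_l & 'I_(n j)}}|.

Let KV := {mpoly K[num_vars]}.

Definition xvar (j : 'I_l) (i : 'I_(n j)) : KV :=
  'X_(enum_rank (Tagged (fun j => 'I_(n j)) i)).

(* An action on K[V], by K-algebra automorphisms, of a group containing sigma. *)
Record jordan_action (gT : finGroupType) (sigma : gT) := JordanAction {
  jact :> gT -> {lrmorphism KV -> KV};
  jact1 : forall f, jact 1%g f = f;
  jactM : forall g h f, jact (g * h)%g f = jact g (jact h f);
  jact_head : forall j (i : 'I_(n j)),
    i = 0%N :> nat -> jact sigma (xvar i) = xvar i;
  jact_next : forall j (i i' : 'I_(n j)),
    i = i'.+1 :> nat -> jact sigma (xvar i) = xvar i + xvar i'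
}.

End JordanAction.

Notation KV K n := {mpoly K[num_vars n]} (only parsing).

Section Invariants.

Variables (K : fieldType) (l : nat) (n : 'I_l -> nat).
Variables (gT : finGroupType) (sigma : gT) (J : jordan_action K n sigma).

Definition invariant : {pred KV K n} := fun f => [forall g, J g f == f].

Lemma invariantP f : reflect (forall g, J g f = f) (f \in invariant).
Proof. exact: 'forall_eqP. Qed.

Fact invariant_subalg_closed : subalg_closed invariant.
Proof.
split=> [|a u v /invariantP uI /invariantP vI|u v /invariantP uI /invariantP vI].
- by apply/invariantP => g; rewrite rmorph1.
- by apply/invariantP => g; rewrite linearP /= uI vI.
- by apply/invariantP => g; rewrite rmorphM /= uI vI.
Qed.

HB.instance Definition _ :=
  GRing.isSubalgClosed.Build K (KV K n) invariant invariant_subalg_closed.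

Record inv_ring := InvRing { inv_val :> KV K n; _ : inv_val \in invariant }.

HB.instance Definition _ := [isSub for inv_val].
HB.instance Definition _ := [Choice of inv_ring by <:].
HB.instance Definition _ := [SubChoice_isSubComNzRing of inv_ring by <:].
HB.instance Definition _ := [SubZmodule_isSubLmodule of inv_ring by <:].
HB.instance Definition _ :=
  [SubNzRing_SubLmodule_isSubLalgebra of inv_ring by <:].
HB.instance Definition _ := [SubLalgebra_isSubAlgebra of inv_ring by <:].

Definition inv_deg (d : nat) (r : inv_ring) : Prop :=
  inv_val r \is d.-homog.

Definition norm_poly (f : KV K n) : KV K n := \prod_(g : gT) J g f.

Fact norm_poly_invariant f : norm_poly f \in invariant.
Proof.
apply/invariantP => h; rewrite /norm_poly rmorph_prod /=.
rewrite [RHS](reindex_inj (mulgI h)) /=.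
by apply: eq_bigr => g _; rewrite jactM.
Qed.

Definition norm (f : KV K n) : inv_ring := InvRing (norm_poly_invariant f).

End Invariants.

Section Transfer.

Variables (K : fieldType) (p : nat) (charKp : p \in [pchar K]).
Variables (l : nat) (n : 'I_l -> nat).
Variables (gT : finGroupType) (sigma : gT) (J : jordan_action K n sigma).

Definition transfer (f : KV K n) : KV K n := \sum_(i < p) iter i (J sigma) f.

(* The characteristic is only used to know that the ideal is proper. *)
Definition transfer_ideal (_ : p \in [pchar K]) : {pred inv_ring J} :=
  fun r => `[< exists f, transfer f = inv_val r >].

Fact jact_const_coeff (f : KV K n) : (J sigma f)@_0 = f@_0.
Proof.
have JX k : (J sigma 'X_k)@_0 = 0.
  rewrite -(enum_valK k); case: (enum_val k) => j i.
  rewrite -/(xvar K i).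
  case: (posnP (i : nat)) => [i0 | i_gt0].
    by rewrite jact_head // mcoeffX mnm1_eq0.
  have lt_i : (i.-1 < n j)%N by rewrite prednK // ltnW.
  rewrite (@jact_next _ _ _ _ _ J j i (Ordinal lt_i)) /= ?prednK //.
  by rewrite mcoeffD !mcoeffX !mnm1_eq0 addr0.
rewrite [in LHS](mpolyE f) [in RHS](mpolyE f) !linear_sum /=.
apply: eq_bigr => m _.
rewrite !linearZ /=; congr (_ * _).
rewrite mpolyXE_id !rmorph_prod /=.
apply: eq_bigr => i _; rewrite !rmorphXn /= JX.
by rewrite mcoeffX mnm1_eq0.
Qed.

Fact transfer_const_coeff f : (transfer f)@_0 = 0.
Proof.
rewrite /transfer raddf_sum /=.
under eq_bigr => i _.
  have -> : (iter i (J sigma) f)@_0 = f@_0.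
    by elim: {i}(i : nat) => //= i IHi; rewrite jact_const_coeff.
  over.
by rewrite sumr_const card_ord (mulrn_pchar charKp).
Qed.

Fact transfer_idealr_closed : idealr_closed (transfer_ideal charKp).
Proof.
split=> [||a u v /asboolP[f fu] /asboolP[g gv]].
- apply/asboolP; exists 0; rewrite /transfer big1 // => i _.
  by elim: (i : nat) => //= k ->; rewrite raddf0.
- apply/asboolP => -[f /(congr1 (mcoeff 0))].
  by rewrite transfer_const_coeff /= mcoeff1 eqxx => /eqP; rewrite eq_sym oner_eq0.
- apply/asboolP; exists (inv_val a * f + g).
  rewrite /= -fu -gv /transfer mulr_sumr -big_split /=.
  apply: eq_bigr => i _; elim: (i : nat) => //= k ->.
  have /invariantP aI := valP a.
  by rewrite rmorphD rmorphM /= aI.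
Qed.

HB.instance Definition _ :=
  isIdealr.Build (inv_ring J) (transfer_ideal charKp) transfer_idealr_closed.

End Transfer.

Arguments inv_deg {K l n gT sigma} J d r.
Arguments transfer_ideal {K p l n gT sigma} J _ _.

Definition quot_deg (R : comNzRingType) (deg : nat -> R -> Prop) (I : idealr R)
    (d : nat) (q : {ideal_quot I}) : Prop :=
  exists2 r, deg d r & q = \pi_{ideal_quot I} r.

Arguments quot_deg {R} deg I d q.

Fact ltn_pred_of_gt1 (m : nat) : (1 < m)%N -> (m.-1 < m)%N.
Proof. by case: m. Qed.

Definition last_ord (m : nat) (m_gt1 : (1 < m)%N) : 'I_m :=
  Ordinal (ltn_pred_of_gt1 m_gt1).

(* Main.v *)
(* Let S = K[V], R = S^G, I = I^G, and let z_j = x_(n_j, j) and N_j = N(z_j).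

   Division with remainder by N_j with respect to z_j yields operators on S that
   commute with G, with the transfer and with the other norms, and are left
   inverse to multiplication by N_j.  Hence N_1, ..., N_l is a regular sequence
   on R, on I and on R / I, and it extends by the invariant x_(1, 1) to a regular
   sequence on R and on I.

   Invariants of large degree lie in I + (N_1, ..., N_l) R.  Indeed, let U_k be
   the ideal (x_(1, j), ..., x_(k, j), N_j) of S.  By descending induction on k,
   the Tate cohomology of S / U_k in degrees 0 and -1 vanishes on the components
   of degree at least p in the variables of the block j: these components are 0
   for k = n_j - 1, and multiplication by x = x_(k+1, j) is injective on the
   cohomology of S / U_k as soon as that of S / U_(k+1) vanishes, whereas x^(p-1)
   kills it, being the opposite of the transfer of x_(k+2, j)^(p-1) modulo U_k.
   So R / I is a finite module over K[N_1, ..., N_l], and some u outside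
   I + (N_1, ..., N_l) R is multiplied into it by R_+.

   Let H^i(M) be the cohomology of the Koszul-like complex of all functions from
   (R_+)^i to M, which plays the role of Ext^i(K, M).  A regular sequence of
   length k on M forces H^i(M) = 0 for i < k.  By the long exact sequence of
   0 -> I -> R -> R / I -> 0, a regular sequence of length l + 2 on I would give
   H^i(R / I) = 0 for i <= l, hence H^0 of R / (I + (N_1, ..., N_l) R) would
   vanish, contradicting the existence of u.  In the same way the depth of R / I
   is at most l.

   Restriction to V^G kills the transfers and sends N_j to z_j^p, so the N_j are
   algebraically independent modulo I, and the preimages of the primes
   (z_1, ..., z_i) form a chain of length l.  There is no longer chain: counting
   monomials shows that any l + 1 elements of R / I are algebraically dependent. *)
Require Import Defs.
From HB Require Import structures.
From mathcomp Require Import all_boot all_order all_algebra all_fingroup.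
From mathcomp Require Import boolp.
From mathcomp.multinomials Require Import mpoly.
From mathcomp Require Import ring.

Set Implicit Arguments.
Unset Strict Implicit.
Unset Printing Implicit Defensive.

Import GRing.Theory.

Local Open Scope ring_scope.
Local Open Scope quotient_scope.

(** * Depth and cohomological vanishing *)

Section Cochains.

Variables (R : comNzRingType) (M : lmodType R).

(** Koszul-like differential: on y_0, ..., y_i it is the alternating sum of the y_j f(...), with y_j
    omitted from the argument. The value 0 on the empty list makes H^0 a group of cocycles without
    coboundaries. *)
Fixpoint cobound (f : seq R -> M) (s : seq R) : M :=
  if s is y :: s' then y *: f s' - cobound (fun t => f (y :: t)) s' else 0.

Lemma coboundB f g s :
  cobound (fun t => f t - g t) s = cobound f s - cobound g s.
Proof.
elim: s f g => [|y s IHs] f g /=; first by rewrite subr0.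
rewrite (IHs (fun t => f (y :: t)) (fun t => g (y :: t))) scalerBr.
by rewrite !opprD !opprK addrACA.
Qed.

Lemma coboundZ a f s : cobound (fun t => a *: f t) s = a *: cobound f s.
Proof.
elim: s f => [|y s IHs] f /=; first by rewrite scaler0.
by rewrite (IHs (fun t => f (y :: t))) scalerBr !scalerA mulrC.
Qed.

Lemma cobound_cobound f s : cobound (cobound f) s = 0.
Proof.
elim: s f => [//|y s IHs] f /=.
rewrite (coboundB (fun t => y *: f t) (cobound (fun t => f (y :: t)))).
by rewrite coboundZ IHs subr0 subrr.
Qed.

(** Quotients M / U are never formed: statements about them are made in M modulo a predicate U. *)
Definition submodule (U : M -> Prop) : Prop :=
  [/\ U 0, forall u v, U u -> U v -> U (u + v) & forall a u, U u -> U (a *: u)].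

Lemma submodule0 U : submodule U -> U 0. Proof. by case. Qed.

Lemma submoduleD U u v : submodule U -> U u -> U v -> U (u + v).
Proof. by case=> _ + _; apply. Qed.

Lemma submoduleZ U a u : submodule U -> U u -> U (a *: u).
Proof. by case=> _ _; apply. Qed.

Lemma submoduleN U u : submodule U -> U u -> U (- u).
Proof. by move=> sU Uu; rewrite -scaleN1r; apply: submoduleZ. Qed.

Lemma submoduleB U u v : submodule U -> U u -> U v -> U (u - v).
Proof. by move=> sU Uu Uv; apply: submoduleD (submoduleN sU Uv). Qed.

Lemma submodule_sum U (I : Type) (r : seq I) (P : pred I) (F : I -> M) :
  submodule U -> (forall i, P i -> U (F i)) -> U (\sum_(i <- r | P i) F i).
Proof.
move=> sU UF; apply: (big_ind U) UF => [|u v]; first exact: submodule0.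
exact: submoduleD.
Qed.

Variable Y : pred R.

Lemma cobound_in U i f : submodule U ->
    (forall s, size s = i -> all Y s -> U (f s)) ->
  forall s, size s = i.+1 -> all Y s -> U (cobound f s).
Proof.
move=> sU; elim: i f => [|i IHi] f Uf [//|y s] /= [szs] /andP[Yy Ys].
  by move/size0nil: szs => -> /=; rewrite subr0; apply: submoduleZ => //; apply: Uf.
apply: submoduleB => //; first by apply: submoduleZ => //; apply: Uf.
by apply: IHi => // t szt Yt; apply: Uf => /=; rewrite ?szt ?Yy.
Qed.

(* Vanishing of the i-th cohomology of M / U.  Cochains are arbitrary functions
   (neither multilinear nor alternating), so short exact sequences of modules
   stay exact, and contraction with an element of Y is a null homotopy for the
   multiplication by that element. *)
Definition acyclic (U : M -> Prop) (i : nat) : Prop :=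
  forall f, (forall s, size s = i.+1 -> all Y s -> U (cobound f s)) ->
  exists g, forall s, size s = i -> all Y s -> U (f s - cobound g s).

Definition regular_ext (U U' : M -> Prop) (a : R) : Prop :=
  [/\ Y a, forall m, U (a *: m) -> U m
    & forall m, U' m <-> exists c, U (m - a *: c)].

(** Contracting a cocycle f with a gives h with a f = d h modulo U, so h is a cocycle modulo U'.
    Writing h = d g + a c yields a f = a d c, and a can be cancelled. *)
Lemma acyclic_lift U U' a k : submodule U -> regular_ext U U' a ->
    (forall i, (i < k)%N -> acyclic U' i) ->
  forall i, (i < k.+1)%N -> acyclic U i.
Proof.
move=> sU [Ya regU defU'] acU' [_|i lt_ik] f Uf.
  exists (fun=> 0) => s /size0nil-> _ /=; rewrite subr0; apply: regU.
  by move: (Uf [:: a] erefl); rewrite /= Ya subr0; apply.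
pose h t := f (a :: t).
have Ufh s : size s = i.+1 -> all Y s -> U (a *: f s - cobound h s).
  by move=> szs Ys; apply: (Uf (a :: s)) => /=; rewrite ?szs ?Ya.
have [|g Ug] := acU' i lt_ik h.
  move=> s szs Ys; apply/defU'; exists (f s).
  by rewrite -opprB; apply: submoduleN; last exact: Ufh.
(* Choice needs a total function; lists of another length or not in [Y] receive the irrelevant value
   0. *)
have /choice[c Uc] : forall s, exists c, size s = i -> all Y s ->
    U (h s - cobound g s - a *: c).
  move=> s.
  have [/andP[/eqP szs Ys]|nYs] := boolP ((size s == i) && all Y s).
    by have /defU'[c] := Ug s szs Ys; exists c.
  by exists 0 => szs Ys; rewrite szs Ys eqxx in nYs.
exists c => s szs Ys; apply: regU.
have := submoduleD sU (Ufh s szs Ys) (cobound_in sU Uc szs Ys).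
rewrite (coboundB (fun t => h t - cobound g t)) (coboundB h) coboundZ.
by rewrite cobound_cobound subr0 addrA subrK scalerBr.
Qed.

(** The exact sequence H^i(M / U) -> H^i(M / U') -> H^(i+1)(M / U), made explicit: d f = a e with e
    a cocycle, e = d g, and f - a g is a cocycle modulo U. *)
Lemma acyclic_descend U U' a i : submodule U -> regular_ext U U' a ->
  acyclic U i -> acyclic U i.+1 -> acyclic U' i.
Proof.
move=> sU [Ya regU defU'] acUi acUi1 f U'f.
have /choice[e Ue] : forall s, exists e, size s = i.+1 -> all Y s ->
    U (cobound f s - a *: e).
  move=> s.
  have [/andP[/eqP szs Ys]|nYs] := boolP ((size s == i.+1) && all Y s).
    by have /defU'[c] := U'f s szs Ys; exists c.
  by exists 0 => szs Ys; rewrite szs Ys eqxx in nYs.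
have [|g Ug] := acUi1 e.
  move=> s szs Ys; apply: regU; have := cobound_in sU Ue szs Ys.
  rewrite (coboundB (cobound f)) coboundZ cobound_cobound sub0r.
  by move/(submoduleN sU); rewrite opprK.
have [|h Uh] := acUi (fun t => f t - a *: g t).
  move=> s szs Ys; rewrite coboundB coboundZ.
  have := submoduleD sU (Ue s szs Ys) (submoduleZ a sU (Ug s szs Ys)).
  by rewrite scalerBr addrA subrK.
exists h => s szs Ys; apply/defU'; exists (g s).
by rewrite addrAC; apply: Uh.
Qed.

Lemma acyclic_of_regular k (U : nat -> M -> Prop) a :
    (forall i, submodule (U i)) ->
    (forall i, (i < k)%N -> regular_ext (U i) (U i.+1) (a i)) ->
  forall i, (i < k)%N -> acyclic (U 0%N) i.
Proof.
elim: k U a => // k IHk U a sU regU.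
apply: (acyclic_lift (sU _) (regU _ (ltn0Sn _))).
by apply: (IHk (fun i => U i.+1) (fun i => a i.+1)) => // i; apply: (regU i.+1).
Qed.

Lemma acyclic_socle k (U : nat -> M -> Prop) a :
    (forall i, submodule (U i)) ->
    (forall i, (i < k)%N -> regular_ext (U i) (U i.+1) (a i)) ->
    (forall i, (i <= k)%N -> acyclic (U 0%N) i) -> acyclic (U k) 0.
Proof.
elim: k U a => [|k IHk] U a sU regU acU; first exact: acU.
apply: (IHk (fun i => U i.+1) (fun i => a i.+1)) => // i le_ik.
  exact: (regU i.+1).
have:= acyclic_descend (sU _) (regU _ (ltn0Sn _)).
by apply; apply: acU; rewrite // ltnW.
Qed.

(** H^0(M / U) is the part of M / U killed by [Y]: an element m is a cochain on the empty list, with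
    coboundary y m at y. *)
Lemma acyclic0 U m : acyclic U 0 -> (forall y, Y y -> U (y *: m)) -> U m.
Proof.
move=> acU Um; have [|g] := acU (fun=> m).
  by case=> [//|y [|//]] /= _ /andP[Yy _]; rewrite subr0; apply: Um.
by move/(_ [::] erefl erefl) => /=; rewrite subr0.
Qed.

End Cochains.

(** * Regular sequences and the submodules they generate *)

Section InitialSubmodules.

Variables (R : comNzRingType) (M : lmodType R).

Lemma initial_submodule k (a : 'I_k -> R) i :
  submodule (in_initial_submod (M := M) a i).
Proof.
split=> [|u v [c ->] [d ->]|b u [c ->]].
- by exists (fun=> 0); rewrite big1 // => j _; rewrite scaler0.
- exists (fun j => c j + d j); rewrite -big_split.
  by apply: eq_bigr => j _; rewrite scalerDr.
- exists (fun j => b *: c j); rewrite scaler_sumr.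
  by apply: eq_bigr => j _; rewrite !scalerA mulrC.
Qed.

Lemma in_initial_submod0 k (a : 'I_k -> R) (m : M) :
  in_initial_submod a 0 m <-> m = 0.
Proof.
split=> [[c ->]|->]; first by rewrite big_pred0.
exact: submodule0 (initial_submodule a 0).
Qed.

Lemma in_initial_submodS k (a : 'I_k -> R) (i : 'I_k) (m : M) :
  in_initial_submod a i.+1 m <-> exists c, in_initial_submod a i (m - a i *: c).
Proof.
have split_sum (c : 'I_k -> M) : \sum_(j < k | (j < i.+1)%N) a j *: c j =
    a i *: c i + \sum_(j < k | (j < i)%N) a j *: c j.
  rewrite (bigD1 i) //=; congr (_ + _); apply: eq_bigl => j.
  by rewrite ltnS ltn_neqAle andbC.
split=> [[c ->]|[c [d /eqP]]].
  by exists (c i); exists c; rewrite split_sum addrC addKr.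
rewrite subr_eq => /eqP ->.
exists (fun j => if j == i then c else d j); rewrite split_sum eqxx addrC.
congr (_ + _); apply: eq_bigr => j lt_ji.
by rewrite -val_eqE /= ltn_eqF.
Qed.

Lemma acyclic_of_regular_seq (deg : nat -> R -> Prop) (Y : pred R) k
    (a : 'I_k -> R) :
    (forall d r, (0 < d)%N -> deg d r -> Y r) ->
    regular_seq deg M a ->
  forall i, (i < k)%N -> acyclic Y (fun m : M => m = 0) i.
Proof.
move=> degY [dega rega] i lt_ik.
have -> : (fun m : M => m = 0) = in_initial_submod a 0.
  by apply/funext => m; apply/propext; rewrite in_initial_submod0.
(* Extends the finite sequence by 0 to all natural indices; only those below k are used. *)
pose b j := oapp a 0 (insub j).
apply: (@acyclic_of_regular _ _ _ k _ b _ _ i lt_ik) => j.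
  exact: initial_submodule.
move=> lt_jk; rewrite /b insubT /=; split.
- by have [d d_gt0] := dega (Ordinal lt_jk); apply: degY.
- exact: (rega (Ordinal lt_jk)).
- exact: (in_initial_submodS a (Ordinal lt_jk)).
Qed.

(** Each regular element lowers by one the range in which cohomology vanishes, so k of them leave
    H^0 of M / U k equal to 0. Its contrapositive bounds depths from above: a nonzero socle element
    forbids the vanishing for [U0]. *)
Lemma socle_obstruction (Y : pred R) (U0 : M -> Prop) k (a : 'I_k -> R) m :
    submodule U0 -> (forall j, Y (a j)) ->
    let U i m := exists2 t, U0 t & in_initial_submod a i (m - t) in
    (forall (i : 'I_k) m, U i (a i *: m) -> U i m) ->
    (forall i, (i <= k)%N -> acyclic Y U0 i) ->
    (forall y, Y y -> U k (y *: m)) -> U k m.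
Proof.
move=> sU0 Ya U regU acU0.
have sU i : submodule (U i).
  have sI := initial_submodule a i; split=> [|u v [t Ut Iu] [t' Ut' Iv]|b u [t Ut Iu]].
  - by exists 0; rewrite ?subr0; apply: submodule0.
  - exists (t + t'); first exact: submoduleD.
    by rewrite opprD addrACA; apply: submoduleD.
  - exists (b *: t); first exact: submoduleZ.
    by rewrite -scalerBr; apply: submoduleZ.
have defU0 : U0 = U 0%N.
  apply/funext => u; apply/propext; split=> [Uu|[t Ut]].
    by exists u; rewrite // subrr; exact: submodule0 (initial_submodule a 0).
  by rewrite in_initial_submod0 => /eqP; rewrite subr_eq0 => /eqP ->.
apply: acyclic0; pose b j := oapp a 0 (insub j).
apply: (@acyclic_socle _ _ _ k U b) => // [j lt_jk|]; last by rewrite -defU0.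
rewrite /b insubT /=; split=> // [|u]; first exact: (regU (Ordinal lt_jk)).
split=> [[t Ut]|[c [t Ut]]].
  move/(in_initial_submodS a (Ordinal lt_jk)) => [c Ic].
  by exists c; exists t; rewrite // addrAC.
rewrite addrAC => Ic; exists t => //.
by apply/(in_initial_submodS a (Ordinal lt_jk)); exists c.
Qed.

End InitialSubmodules.

Section IdealModuleTheory.

Variables (R : comNzRingType) (I : idealr R).

Lemma ideal_valP (x : ideal_module I) : ideal_val x \in I.
Proof. by case: x. Qed.

Lemma ideal_val_inj : injective (@ideal_val R I).
Proof. exact: (@val_inj R^o _ (ideal_module I)). Qed.

Lemma ideal_valB (x y : ideal_module I) :
  ideal_val (x - y) = ideal_val x - ideal_val y.
Proof. exact: (@raddfB _ _ (\val : ideal_module I -> R^o)). Qed.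

Lemma ideal_val0 : ideal_val (0 : ideal_module I) = 0.
Proof. by []. Qed.

Lemma ideal_valZ a (x : ideal_module I) : ideal_val (a *: x) = a * ideal_val x.
Proof. by []. Qed.

End IdealModuleTheory.

(* Diagram chase in the long exact sequence of 0 -> I -> R -> R / I -> 0. *)
Lemma acyclic_quotient (R : comNzRingType) (I : idealr R) (Y : pred R) k :
    acyclic Y (fun m : R^o => m = 0) k ->
    acyclic Y (fun m : ideal_module I => m = 0) k.+1 ->
  acyclic Y (fun m : R^o => m \in I) k.
Proof.
move=> acR acI f If.
(* The connecting map: the coboundary of f takes values in I on the relevant lists, and the default
   0 is used only elsewhere. *)
pose f' s : ideal_module I := insubd 0 (cobound f s).
have valf' s : size s = k.+1 -> all Y s -> ideal_val (f' s) = cobound f s.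
  by move=> szs Ys; apply: (@insubdK R^o _ (ideal_module I)); apply: If.
have val_cobound (g : seq R -> ideal_module I) s :
    ideal_val (cobound g s) = cobound (fun t => ideal_val (g t)) s.
  elim: s g => [//|y s IHs] g.
  rewrite -[cobound g _]/(y *: g s - cobound (fun t => g (y :: t)) s).
  by rewrite ideal_valB ideal_valZ IHs.
have sub0 : submodule (fun m : R^o => m = 0).
  by split=> // [u v -> ->|b u ->]; rewrite ?addr0 ?scaler0.
have [|g f'g] := acI f'.
  move=> s szs Ys; apply: ideal_val_inj; rewrite val_cobound ideal_val0.
  have := cobound_in (f := fun t => ideal_val (f' t) - cobound f t) sub0 _ szs Ys.
  rewrite coboundB cobound_cobound subr0; apply => t szt Yt.
  by rewrite valf' // subrr.
have [|h fh] := acR (fun t => f t - ideal_val (g t)).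
  move=> s szs Ys; rewrite coboundB -val_cobound -valf' // -ideal_valB.
  by rewrite f'g.
exists h => s szs Ys; have := fh s szs Ys.
rewrite addrAC => /eqP; rewrite subr_eq0 => /eqP ->.
exact: ideal_valP.
Qed.

(** * Regular sequences from left inverses; chains of primes *)

Section LeftInverses.

Variables (R : comNzRingType) (M : lmodType R) (k : nat) (a : 'I_k -> R).

Lemma additive_initial_submod (q : M -> M) i : {morph q : u v / u + v} ->
    (forall j : 'I_k, (j < i)%N -> forall m, q (a j *: m) = a j *: q m) ->
  forall m, in_initial_submod a i m -> in_initial_submod a i (q m).
Proof.
move=> qD qa _ [c ->]; exists (q \o c).
have q0 : q 0 = 0 by apply: (addIr (q 0)); rewrite -qD !add0r.
by rewrite (big_morph q qD q0); apply: eq_bigr => j lt_ji; rewrite qa.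
Qed.

(** Apply q to a relation a_i m = t + sum_j a_j c_j: it becomes m = q(t) + sum_j a_j q(c_j). *)
Lemma regular_left_inverse (U : M -> Prop) (i : 'I_k) (q : M -> M) :
    {morph q : u v / u + v} -> (forall m, q (a i *: m) = m) ->
    (forall j : 'I_k, (j < i)%N -> forall m, q (a j *: m) = a j *: q m) ->
    (forall m, U m -> U (q m)) ->
  forall m, (exists2 t, U t & in_initial_submod a i (a i *: m - t)) ->
            exists2 t, U t & in_initial_submod a i (m - t).
Proof.
move=> qD qai qa qU m [t Ut] /(additive_initial_submod qD qa).
have q0 : q 0 = 0 by apply: (addIr (q 0)); rewrite -qD !add0r.
have qN u : q (- u) = - q u by apply: (addIr (q u)); rewrite -qD !addNr.
by rewrite qD qN qai; exists (q t); first exact: qU.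
Qed.

(* r = prod_(j < i) (1 - a_j q_j) is a projector killing (a_0, ..., a_(i-1)) M. *)
Lemma initial_submod_projector (q : 'I_k -> M -> M) (x : R) i : (i <= k)%N ->
    (forall j : 'I_k, (j < i)%N -> {morph q j : u v / u + v}) ->
    (forall j : 'I_k, (j < i)%N -> forall m, q j (a j *: m) = m) ->
    (forall j j' : 'I_k, (j' < j < i)%N ->
       forall m, q j (a j' *: m) = a j' *: q j m) ->
    (forall j : 'I_k, (j < i)%N -> forall m, q j (x *: m) = x *: q j m) ->
  exists r : M -> M, [/\ {morph r : u v / u + v},
    forall m, r (x *: m) = x *: r m, forall m, in_initial_submod a i (m - r m)
    & forall j : 'I_k, (j < i)%N -> forall m, r (a j *: m) = 0].
Proof.
elim: i => [|i IHi] lt_ik qD qa qaC qx.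
  by exists id; split=> // m; rewrite subrr; apply/in_initial_submod0.
have [||||r [rD rx rI ra]] := IHi (ltnW lt_ik).
- by move=> j lt_ji; apply: qD; rewrite ltnW.
- by move=> j lt_ji; apply: qa; rewrite ltnW.
- by move=> j j' /andP[lt_jj' lt_ji]; apply: qaC; rewrite lt_jj' (ltn_trans lt_ji).
- by move=> j lt_ji; apply: qx; rewrite ltnW.
pose i' := Ordinal lt_ik; have qDi := qD i' (ltnSn i).
have q0 : q i' 0 = 0 by apply: (addIr (q i' 0)); rewrite -qDi !add0r.
exists (fun m => r (m - a i' *: q i' m)); split=> [u v|m|m|j].
- by rewrite qDi scalerDr opprD addrACA; apply: rD.
- by rewrite qx // scalerA mulrC -scalerA -scalerBr rx.
- apply/(in_initial_submodS a i'); exists (q i' m).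
  by rewrite addrAC; apply: rI.
- rewrite ltnS leq_eqVlt => /orP[/eqP def_j|lt_ji] m.
    have -> : j = i' by apply: val_inj.
    rewrite qa // subrr; apply: (addIr (r 0)).
    by rewrite -rD !add0r.
  rewrite qaC; last by rewrite lt_ji /= ltnSn.
  by rewrite scalerA mulrC -scalerA -scalerBr ra.
Qed.

(** Left inverses are needed only before index i. The projector r commutes with a_i and kills the
    earlier terms, so a_i r(m) = 0; hence r(m) = 0, and m = m - r(m) lies in the initial
    submodule. *)
Lemma regular_initial_projector (q : 'I_k -> M -> M) (i : 'I_k) :
    (forall j : 'I_k, (j < i)%N -> {morph q j : u v / u + v}) ->
    (forall j : 'I_k, (j < i)%N -> forall m, q j (a j *: m) = m) ->
    (forall j j' : 'I_k, (j < i)%N -> j' != j ->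
       forall m, q j (a j' *: m) = a j' *: q j m) ->
    (forall m : M, a i *: m = 0 -> m = 0) ->
  forall m : M, in_initial_submod a i (a i *: m) -> in_initial_submod a i m.
Proof.
move=> qD qa qaC rega m [c def_c].
have [||||r [rD rx rI ra]] := @initial_submod_projector q (a i) i (ltnW (ltn_ord i)).
- exact: qD.
- exact: qa.
- by move=> j j' /andP[lt_jj' lt_ji]; apply: qaC; rewrite // -val_eqE /= ltn_eqF.
- by move=> j lt_ji; apply: qaC; rewrite // -val_eqE /= gtn_eqF.
have r0 : r 0 = 0 by apply: (addIr (r 0)); rewrite -rD !add0r.
rewrite -[m]subr0 -(rega (r m)) // -rx def_c (big_morph r rD r0).
by rewrite big1 // => j lt_ji; rewrite ra.
Qed.

End LeftInverses.

(* If y_i lies in P_(i+1) but not in P_i, then y_0, ..., y_(k-1) satisfy no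
   algebraic relation modulo P_0: cancel successively the smallest power of
   y_0, y_1, ... occurring in a relation, each time passing to the next prime
   (Coquand and Lombardi's elementary characterization of Krull dimension). *)
Lemma prime_chain_free (K : fieldType) (R : comAlgType K) k
    (P : nat -> {pred R}) (y : 'I_k -> R) (T : finType) (mu : T -> 'I_k -> nat)
    (c : T -> K) :
    (forall i, (i <= k)%N -> prime_ideal (P i)) ->
    (forall i : 'I_k, {subset P i <= P i.+1}) ->
    (forall i : 'I_k, y i \in P i.+1 /\ y i \notin P i) ->
    (forall t t', mu t =1 mu t' -> t = t') ->
    \sum_t c t *: \prod_i y i ^+ mu t i \in P 0%N ->
  forall t, c t = 0.
Proof.
move=> primeP subP yP mu_inj P0 t0; apply/eqP/negP => /negP ct0.
have PM i a b : (i <= k)%N -> b \in P i -> a * b \in P i.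
  move=> le_ik bP; have [[P_0 _ Plin] _] := primeP i le_ik.
  by rewrite -[a * b]addr0; apply: Plin.
have PB i a b : (i <= k)%N -> a \in P i -> b \in P i -> a - b \in P i.
  move=> le_ik aP bP; have [[P_0 _ Plin] _] := primeP i le_ik.
  by rewrite addrC -mulN1r; apply: Plin.
(* [S] holds the terms surviving i cancellations: their exponents agree in the first i variables,
   whose powers have been divided out. *)
have claim i : (i <= k)%N -> exists S : {set T}, [/\ exists t, t \in S,
    forall t, t \in S -> c t != 0,
    forall t t', t \in S -> t' \in S ->
      forall j : 'I_k, (j < i)%N -> mu t j = mu t' j
  & \sum_(t in S) c t *: \prod_(j < k | (i <= j)%N) y j ^+ mu t j \in P i].
  elim: i => [_|i IHi lt_ik].
    exists [set t | c t != 0]; split=> [|t||]; rewrite ?inE //.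
      by exists t0; rewrite inE.
    rewrite (bigID (fun t => c t == 0)) /= big1 ?add0r in P0; last first.
      by move=> t /eqP ->; rewrite scale0r.
    rewrite (eq_bigl (fun t => c t != 0)) => [|t]; last by rewrite inE.
    by rewrite [X in X \in _](eq_bigr _ (fun=> fun=> erefl)).
  have [S [[t1 t1S] cS eqS SP]] := IHi (ltnW lt_ik).
  pose i' := Ordinal lt_ik.
  have [t2 t2S min_t2] : exists2 t2, t2 \in S &
      forall t, t \in S -> (mu t2 i' <= mu t i')%N.
    by have [t2] := arg_minnP (P := fun t => t \in S) (fun t => mu t i') t1S; exists t2.
  (* Only the terms of least exponent in y_i survive. That power cancels because y_i is outside the
     prime P_i, and every other term keeps a factor y_i, so it lies in P_(i+1). *)
  exists [set t in S | mu t i' == mu t2 i']; split.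
  - by exists t2; rewrite inE t2S eqxx.
  - by move=> t; rewrite inE => /andP[/cS].
  - move=> t t'; rewrite !inE => /andP[tS /eqP mut] /andP[t'S /eqP mut'] j.
    rewrite ltnS leq_eqVlt => /orP[/eqP def_j|]; last exact: eqS.
    have -> : j = i' by apply: val_inj.
    by rewrite mut.
  have [yP' yNP] := yP i'; have [[_ _ Plin] Pprime] := primeP i (ltnW lt_ik).
  have prod_split t : \prod_(j < k | (i <= j)%N) y j ^+ mu t j =
      y i' ^+ mu t i' * \prod_(j < k | (i < j)%N) y j ^+ mu t j.
    rewrite (bigD1 i') //=; congr (_ * _); apply: eq_bigl => j.
    by rewrite ltn_neqAle andbC eq_sym.
  pose w t := c t *: \prod_(j < k | (i < j)%N) y j ^+ mu t j.
  have PN u v : u \notin P i -> u * v \in P i -> v \in P i.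
    by move=> /negbTE uN /Pprime; rewrite uN.
  have yXN e : y i' ^+ e \notin P i.
    elim: e => [|e IHe].
      by have [[_ oneN _] _] := primeP i (ltnW lt_ik).
    by rewrite exprS; apply/negP => /Pprime; rewrite (negbTE yNP) (negbTE IHe).
  have S2P : \sum_(t in S) y i' ^+ (mu t i' - mu t2 i') * w t \in P i.
    apply: (PN (y i' ^+ mu t2 i')); first exact: yXN.
    suff <- : \sum_(t in S) c t *: \prod_(j < k | (i <= j)%N) y j ^+ mu t j =
      y i' ^+ mu t2 i' * \sum_(t in S) y i' ^+ (mu t i' - mu t2 i') * w t by [].
    rewrite mulr_sumr; apply: eq_bigr => t tS.
    by rewrite prod_split mulrA -exprD subnKC ?min_t2 // /w scalerAr.
  have {}S2P := subP i' _ S2P; rewrite -[i'.+1]/(i.+1) in S2P.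
  rewrite (bigID (fun t => mu t i' == mu t2 i')) /= in S2P.
  have := PB i.+1 _ _ lt_ik S2P.
  move=> /(_ (\sum_(t in S | mu t i' != mu t2 i')
                y i' ^+ (mu t i' - mu t2 i') * w t)).
  rewrite addrK => S3P.
  suff S4P : \sum_(t in S | mu t i' == mu t2 i')
                 y i' ^+ (mu t i' - mu t2 i') * w t \in P i.+1.
    suff <- : \sum_(t in S | mu t i' == mu t2 i')
                y i' ^+ (mu t i' - mu t2 i') * w t =
      \sum_(t in [set t in S | mu t i' == mu t2 i']) w t by [].
    apply: eq_big => [t|t /andP[_ /eqP->]]; first by rewrite inE.
    by rewrite subnn mul1r.
  apply: S3P; have [[P_0 _ Plin'] _] := primeP i.+1 lt_ik.
  apply: (big_ind (fun u => u \in P i.+1)) => // [u v uP vP|t /andP[tS ne_mu]].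
    by rewrite -[u]mul1r; apply: Plin'.
  have lt_mu : (mu t2 i' < mu t i')%N by rewrite ltn_neqAle eq_sym ne_mu min_t2.
  by rewrite -[(_ - _)%N]prednK ?subn_gt0 // exprSr mulrAC; apply: PM.
(* After k cancellations all exponents agree, so a single term is left: a nonzero constant in the
   proper ideal P_k. *)
have [S [[t tS] cS eqS SP]] := claim k (leqnn k).
have [[_ oneN _] _] := primeP k (leqnn k).
have defS : S = [set t].
  apply/setP => t'; rewrite inE; apply/idP/eqP => [t'S|-> //].
  by apply: mu_inj => j; apply: eqS.
move: SP; rewrite defS big_set1 big1 => [SP|j]; last by rewrite leqNgt ltn_ord.
have := PM k ((c t)^-1)%:A _ (leqnn k) SP.
by rewrite -scalerAl mul1r scalerA mulVf ?cS // scale1r (negbTE oneN).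
Qed.

(** * Linear algebra in finite dimension *)

Section FiniteDimension.

Variable K : fieldType.

Lemma nontrivial_relation m n (A : 'M[K]_(m, n)) : (n < m)%N ->
  exists2 u : 'rV[K]_m, u != 0 & u *m A = 0.
Proof.
move=> lt_nm; have : kermx A != 0.
  rewrite -mxrank_eq0 mxrank_ker subn_eq0 -ltnNge.
  exact: leq_ltn_trans (rank_leq_col A) lt_nm.
case/rowV0Pn=> u uA u0; exists u => //.
by apply/eqP; rewrite -sub_kermx.
Qed.

(** Take a matrix of maximal rank among those with rows in P: appending another row from P cannot
    raise the rank. *)
Lemma subspace_spanned n (P : 'rV[K]_n -> Prop) : P 0 ->
    (forall c u v, P u -> P v -> P (c *: u + v)) ->
  exists m (A : 'M[K]_(m, n)), (forall i, P (row i A)) /\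
    (forall u, P u -> (u <= A)%MS).
Proof.
move=> P0 Plin.
pose Q r := `[< exists m (A : 'M[K]_(m, n)), (forall i, P (row i A)) /\ \rank A = r >].
have exQ : exists r, Q r.
  by exists 0%N; apply/asboolP; exists 0%N, 0; split=> [[]//|]; rewrite mxrank0.
have leQ r : Q r -> (r <= n)%N.
  by move=> /asboolP[m [A [_ <-]]]; apply: rank_leq_col.
have [r /asboolP[m [A [PA rkA]]] maxr] := ex_maxnP exQ leQ.
exists m, A; split=> // u Pu.
have PB i : P (row i (col_mx A u)).
  rewrite -[i]splitK; case: (split i) => j /=.
    by rewrite rowKu.
  by rewrite rowKd (_ : row j u = u) //; apply/rowP => k; rewrite mxE ord1.
have : (\rank (col_mx A u) <= r)%N.
  by apply: maxr; apply/asboolP; exists (m + 1)%N, (col_mx A u).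
rewrite -rkA -addsmxE => le_rk.
have : (A + u <= A)%MS.
  by rewrite -(geq_leqif (mxrank_leqif_sup (addsmxSl A u))).
by rewrite addsmx_sub => /andP[].
Qed.

End FiniteDimension.

(** * Substitutions, gradings and division in polynomial rings *)

Section PowerSums.

Variables (K : fieldType) (p : nat) (charKp : p \in [pchar K]).

Let powsum m : K := \sum_(i < p) i%:R ^+ m.

(** The differences (i+1)^(m+1) - i^(m+1) telescope to p^(m+1) = 0. Expanding them expresses (m+1)
    [powsum m] through lower power sums, and m + 1 is invertible since it is less than p. *)
Lemma pchar_powsum0 m : (m < p.-1)%N -> powsum m = 0.
Proof.
have p_gt0 : (0 < p)%N by rewrite prime_gt0 ?(pcharf_prime charKp).
elim/ltn_ind: m => m IHm lt_mp.
have /esym : \sum_(i < p) ((i.+1)%:R ^+ m.+1 - i%:R ^+ m.+1 : K) = 0.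
  rewrite -(big_mkord xpredT (fun i => i.+1%:R ^+ m.+1 - i%:R ^+ m.+1 : K)).
  rewrite telescope_sumr // (pcharf0 charKp) expr0n /= subrr //.
have -> : \sum_(i < p) ((i.+1)%:R ^+ m.+1 - i%:R ^+ m.+1 : K) =
    \sum_(j < m.+1) powsum j *+ 'C(m.+1, j).
  under [RHS]eq_bigr => j _ do rewrite /powsum -sumrMnl.
  rewrite exchange_big; apply: eq_bigr => i _ /=.
  by rewrite -natr1 exprD1n big_ord_recr /= binn mulr1n addrK.
rewrite big_ord_recr big1 /= => [|j _]; last first.
  by rewrite IHm ?mul0rn // (ltn_trans (ltn_ord j)).
rewrite add0r binSn -mulr_natr => /esym/eqP.
rewrite mulf_eq0 -(dvdn_pcharf charKp) gtnNdvd ?orbF //; first by move/eqP.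
by rewrite -ltnS prednK in lt_mp *.
Qed.

Lemma pchar_powsum_pred : powsum p.-1 = -1.
Proof.
have p_pr := pcharf_prime charKp; have p_gt0 := prime_gt0 p_pr.
rewrite /powsum -(big_mkord xpredT (fun i => i%:R ^+ p.-1 : K)) big_ltn //.
rewrite expr0n eqn0Ngt -subn1 subn_gt0 prime_gt1 //= add0r.
rewrite (eq_big_nat _ _ (F2 := fun=> 1)) => [|i /andP[i_gt0 lt_ip]].
  by rewrite sumr_const_nat natrB // (pcharf0 charKp) sub0r.
have i0 : i%:R != 0 :> K by rewrite -(dvdn_pcharf charKp) gtnNdvd.
apply: (mulfI i0); rewrite -exprS subn1 prednK // mulr1.
exact: (pFrobenius_aut_nat charKp).
Qed.

(* The sum is the transfer of x' ^ (p - 1) when sigma x' = x' + x. *)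
Lemma sum_translates_pred (A : comAlgType K) (x x' : A) :
  \sum_(i < p) (x' + x *+ i) ^+ p.-1 = - x ^+ p.-1.
Proof.
have E (i : 'I_p) : (x' + x *+ i) ^+ p.-1 =
    \sum_(j < p.-1.+1) ((i%:R : K) ^+ j) *: (x' ^+ (p.-1 - j) * x ^+ j *+ 'C(p.-1, j)).
  rewrite exprDn; apply: eq_bigr => j _.
  by rewrite -[x *+ i]mulr_natl exprMn mulrCA -!natrX scaler_nat mulr_natl mulrnAC.
under eq_bigr do rewrite E; rewrite exchange_big /=.
under eq_bigr do rewrite -scaler_suml.
rewrite big_ord_recr big1 /= => [|j _]; last by rewrite -/(powsum j) pchar_powsum0 ?scale0r.
by rewrite -/(powsum _) pchar_powsum_pred subnn expr0 mul1r binn mulr1n add0r scaleN1r.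
Qed.

End PowerSums.

Section Substitution.

Variables (K : fieldType) (n : nat).

Lemma mpoly_rmorph_ext (T : comNzRingType) (f g : {rmorphism {mpoly K[n]} -> T}) :
  (forall c, f c%:MP = g c%:MP) -> (forall i, f 'X_i = g 'X_i) -> f =1 g.
Proof.
move=> eqC eqX h; rewrite [h]mpolyE !rmorph_sum; apply: eq_bigr => m _.
rewrite -mul_mpolyC !rmorphM /= eqC; congr (_ * _).
rewrite mpolyXE_id !rmorph_prod; apply: eq_bigr => i _.
by rewrite !rmorphXn /= eqX.
Qed.

Lemma mpolyX_neq0 m : 'X_[m] != 0 :> {mpoly K[n]}.
Proof. by rewrite -msize_poly_eq0 msizeX. Qed.

Lemma lrmorphC (A : algType K) (f : {lrmorphism {mpoly K[n]} -> A}) c :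
  f c%:MP = c%:A.
Proof. by rewrite -alg_mpolyC linearZ /= rmorph1. Qed.

Definition subst k (h : 'I_n -> {mpoly K[k]}) : {mpoly K[n]} -> {mpoly K[k]} :=
  comp_mpoly [tuple h i | i < n].

HB.instance Definition _ k (h : 'I_n -> {mpoly K[k]}) :=
  GRing.Linear.on (subst h).
HB.instance Definition _ k (h : 'I_n -> {mpoly K[k]}) :=
  GRing.RMorphism.on (subst h).

Lemma substX k (h : 'I_n -> {mpoly K[k]}) i : subst h 'X_i = h i.
Proof. by rewrite /subst comp_mpolyXU -tnth_nth tnth_mktuple. Qed.

Lemma substC k (h : 'I_n -> {mpoly K[k]}) c : subst h c%:MP = c%:MP.
Proof. exact: comp_mpolyC. Qed.

Lemma substXm k (h : 'I_n -> {mpoly K[k]}) m :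
  subst h 'X_[m] = \prod_i h i ^+ m i.
Proof.
by rewrite /subst comp_mpolyX; apply: eq_bigr => i _; rewrite tnth_mktuple.
Qed.

(** Models reduction modulo the variables in P, with the quotient realized inside the same
    polynomial ring. *)
Definition kill (P : pred 'I_n) := subst (fun i => if P i then 0 else 'X_i).

HB.instance Definition _ P := GRing.Linear.on (kill P).
HB.instance Definition _ P := GRing.RMorphism.on (kill P).

Lemma killX P i : kill P 'X_i = if P i then 0 else 'X_i.
Proof. exact: substX. Qed.

Lemma kill_kill P Q f : kill P (kill Q f) = kill (predU P Q) f.
Proof.
apply: (mpoly_rmorph_ext (f := kill P \o kill Q)) => [c|i] /=.
  by rewrite /kill !substC.
by rewrite !killX /=; case: (Q i); rewrite ?orbT ?raddf0 ?orbF ?killX.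
Qed.

Lemma eq_kill P Q : P =1 Q -> kill P =1 kill Q.
Proof.
move=> eqPQ; apply: mpoly_rmorph_ext => [c|i] /=; first by rewrite /kill !substC.
by rewrite !killX eqPQ.
Qed.

Lemma kill_pred0 f : kill pred0 f = f.
Proof.
apply: (mpoly_rmorph_ext (g := idfun)) => [c|i] /=; first exact: substC.
exact: killX.
Qed.

(** The monomials of f free of X_k are unchanged by the substitution, so they add up to 0. *)
Lemma kill1_eq0 k f : kill (pred1 k) f = 0 -> exists g, f = 'X_k * g.
Proof.
move=> f0; pose a (m : 'X_{1..n}) : {mpoly K[n]} := f@_m *: 'X_[m].
have def_f : f = \sum_(m <- msupp f | m k == 0%N) a m +
    'X_k * \sum_(m <- msupp f | m k != 0%N) f@_m *: 'X_[m - U_(k)].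
  rewrite [LHS]mpolyE (bigID (fun m : 'X_{1..n} => m k == 0%N)) /=; congr (_ + _).
  rewrite mulr_sumr; apply: eq_bigr => m mk; rewrite -scalerAr -mpolyXD.
  by rewrite addmC submK // lep1mP.
have := congr1 (kill (pred1 k)) def_f.
rewrite f0 rmorphD rmorphM /= killX /= eqxx mul0r addr0 raddf_sum /= => /esym.
rewrite (eq_bigr a) => [a0|m /eqP mk].
  by exists (\sum_(m <- msupp f | m k != 0%N) f@_m *: 'X_[m - U_(k)]);
    rewrite {1}def_f a0 add0r.
rewrite linearZ /= /kill substXm /a; congr (_ *: _).
rewrite mpolyXE_id; apply: eq_bigr => i _ /=.
by have [->|] := eqVneq i k; rewrite ?mk ?expr0.
Qed.

End Substitution.

Section Gradings.

Variables (K : fieldType) (n : nat).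

Lemma homog_var_prod (mf : measure n) (h : 'I_n -> {mpoly K[n]}) (e : 'I_n -> nat) m :
    (forall i, h i \is (e i).-homog for mf) ->
  \prod_i h i ^+ m i \is (\sum_i e i * m i)%N.-homog for mf.
Proof.
move=> hom; apply: (big_ind2 (fun u d => u \is d.-homog for mf)).
- exact: dhomog1.
- by move=> u d v d'; apply: dhomogM.
- by move=> i _; apply: dhomogMn.
Qed.

Variables (mf : measure n) (s : {lrmorphism {mpoly K[n]} -> {mpoly K[n]}}).
Hypothesis homs : forall i, s 'X_i \is (mf U_(i)%MM).-homog for mf.

Lemma lrmorph_homog d f : f \is d.-homog for mf -> s f \is d.-homog for mf.
Proof.
move=> homf; rewrite [f]mpolyE linear_sum big_seq; apply: rpred_sum => m mf_m.
rewrite linearZ /=; apply: rpredZ; rewrite -(dhomog_mf homf mf_m) [mf m]mfE.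
rewrite mpolyXE_id rmorph_prod /=.
have -> : (\sum_i m i * mf U_(i)%MM = \sum_i mf U_(i)%MM * m i)%N.
  by apply: eq_bigr => i _; rewrite mulnC.
by under eq_bigr do rewrite rmorphXn /=; apply: homog_var_prod.
Qed.

Lemma lrmorph_pihomog d f : s (pihomog mf d f) = pihomog mf d (s f).
Proof.
(* Large enough for f to be the sum of its components below k, and for d to be one of these
   indices. *)
pose k := maxn (mmeasure mf f) d.+1.
have lt_dk : (d < k)%N by rewrite leq_max ltnSn orbT.
have -> : pihomog mf d (s f) = \sum_(e < k) pihomog mf d (s (pihomog mf e f)).
  by rewrite [in LHS](@pihomog_partitionE _ _ mf k f) ?leq_maxl // !linear_sum.
rewrite (bigD1 (Ordinal lt_dk)) //= big1 ?addr0 => [|e]; last first.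
  move=> ne; have ne_ed : e != d :> nat.
    by apply: contraNneq ne => def_e; apply/eqP/val_inj.
  by apply: (@pihomog_ne0 _ _ _ e) => //; apply/lrmorph_homog/pihomogP.
by rewrite [RHS]pihomog_dE //; apply/lrmorph_homog/pihomogP.
Qed.

End Gradings.

Lemma pihomogM (K : fieldType) (n : nat) (mf : measure n) (a f : {mpoly K[n]}) e d :
  a \is e.-homog for mf ->
  pihomog mf d (a * f) = if (e <= d)%N then a * pihomog mf (d - e) f else 0.
Proof.
move=> homa; pose k := maxn (mmeasure mf f) d.+1.
have -> : pihomog mf d (a * f) = \sum_(i < k) pihomog mf d (a * pihomog mf i f).
  rewrite [in LHS](@pihomog_partitionE _ _ mf k f) ?leq_maxl // mulr_sumr.
  exact: linear_sum.
have hom_i i : a * pihomog mf i f \is (e + i).-homog for mf.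
  exact/dhomogM/pihomogP.
case: leqP => [le_ed|lt_de] /=.
  have lt_dk : (d - e < k)%N.
    by rewrite leq_max ltnS leq_subr orbT.
  rewrite (bigD1 (Ordinal lt_dk)) //= big1 ?addr0 => [|i ne_i].
    by rewrite pihomog_dE // -{2}(subnKC le_ed).
  apply: (@pihomog_ne0 _ _ _ (e + i)) => //.
  by apply: contraNneq ne_i => def_d; rewrite -val_eqE /= -def_d addKn.
rewrite big1 // => i _; apply: (@pihomog_ne0 _ _ _ (e + i)) => //.
by rewrite neq_ltn (leq_trans lt_de) ?leq_addr ?orbT.
Qed.

Lemma mcoeff_pihomog (K : fieldType) (n : nat) (mf : measure n) d
    (f : {mpoly K[n]}) m :
  (pihomog mf d f)@_m = if mf m == d then f@_m else 0.
Proof.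
have [mf_m|ne_d] := eqVneq (mf m) d; last exact: dhomog_nemf_coeff (pihomogP _ _ _) ne_d.
rewrite [in RHS](@pihomog_partitionE _ _ mf (maxn (mmeasure mf f) d.+1) f) ?leq_maxl //.
have lt_d : (d < maxn (mmeasure mf f) d.+1)%N by rewrite leq_max ltnSn orbT.
rewrite [RHS]raddf_sum [RHS](bigD1 (Ordinal lt_d)) //=.
rewrite [X in _ + X]big1 ?addr0 // => e ne_e; apply: dhomog_nemf_coeff (pihomogP _ _ _) _.
by rewrite mf_m; apply: contraNneq ne_e => def_d; apply/eqP/val_inj.
Qed.

(** * Division by a polynomial monic in one variable *)

Section DivisionByMonic.

Variables (K : fieldType) (n : nat) (z : 'I_n).

(* The polynomial ring as polynomials in X_z, the other variables being kept in
   the coefficients. *)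
Definition expand : {mpoly K[n]} -> {poly {mpoly K[n]}} :=
  mmap (polyC \o @mpolyC n K) (fun k => if k == z then 'X else ('X_k)%:P).

HB.instance Definition _ := GRing.RMorphism.on expand.

Lemma expandX k : expand 'X_k = if k == z then 'X else ('X_k)%:P.
Proof. by rewrite /expand mmapX mmap1U. Qed.

Lemma expandC c : expand c%:MP = c%:MP%:P.
Proof. by rewrite /expand mmapC. Qed.

Lemma expandK f : (expand f).['X_z] = f.
Proof.
apply: (mpoly_rmorph_ext (f := horner_eval 'X_z \o expand) (g := idfun)) => [c|k] /=.
  by rewrite /horner_eval expandC hornerC.
by rewrite /horner_eval expandX; case: eqP => [->|_]; rewrite ?hornerX ?hornerC.
Qed.

Section Quotient.

Variable N : {mpoly K[n]}.
Hypothesis monN : expand N \is monic.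

Definition quo f : {mpoly K[n]} := (Pdiv.Ring.rdivp (expand f) (expand N)).['X_z].

Lemma quoP f : exists q r : {poly {mpoly K[n]}}, [/\ quo f = q.['X_z],
  (size r < size (expand N))%N & expand f = q * expand N + r].
Proof.
exists (Pdiv.Ring.rdivp (expand f) (expand N)).
exists (Pdiv.Ring.rmodp (expand f) (expand N)); split=> //.
  by rewrite Pdiv.Ring.ltn_rmodp monic_neq0.
exact: Pdiv.RingMonic.rdivp_eq.
Qed.

Lemma quo_unique f (q r : {poly {mpoly K[n]}}) : (size r < size (expand N))%N ->
  expand f = q * expand N + r -> quo f = q.['X_z].
Proof.
by move=> lt_r def_f; rewrite /quo def_f Pdiv.RingMonic.rdivp_addl_mul_small.
Qed.

Lemma quoD : {morph quo : f g / f + g}.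
Proof.
move=> f g; have [q [r [-> lt_r def_f]]] := quoP f.
have [q' [r' [-> lt_r' def_g]]] := quoP g.
rewrite -hornerD; apply: (quo_unique (r := r + r')).
  by rewrite (leq_ltn_trans (size_polyD _ _)) // gtn_max lt_r.
by rewrite (rmorphD expand) /= def_f def_g mulrDl addrACA.
Qed.

Lemma quoMN f : quo (N * f) = f.
Proof.
rewrite (quo_unique (q := expand f) (r := 0)) ?expandK //.
  by rewrite size_poly0 size_poly_gt0 monic_neq0.
by rewrite addr0 [N * f]mulrC; apply: (rmorphM expand).
Qed.

Lemma quo_const c f : expand c = c%:P -> quo (c * f) = c * quo f.
Proof.
move=> cC; have [q [r [-> lt_r def_f]]] := quoP f.
rewrite -[c in RHS](hornerC c 'X_z) -hornerM.
apply: (quo_unique (r := c%:P * r)).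
  by rewrite mul_polyC (leq_ltn_trans (size_scale_leq _ _)).
by rewrite (rmorphM expand) /= cC def_f mulrDr mulrA.
Qed.

End Quotient.

Section EquivariantExpansion.

Variables (s : {lrmorphism {mpoly K[n]} -> {mpoly K[n]}}) (w : {mpoly K[n]}).
Hypotheses (sz : s 'X_z = 'X_z + w) (wC : expand w = w%:P).
Hypothesis sC : forall k, k != z -> expand (s 'X_k) = (s 'X_k)%:P.

(** Since w and the images of the other variables are free of X_z, s acts on the coefficients and
    translates the main variable by w. *)
Lemma expand_comm f : expand (s f) = map_poly s (expand f) \Po ('X + w%:P).
Proof.
apply: (mpoly_rmorph_ext (f := expand \o s)
  (g := (comp_poly ('X + w%:P) \o map_poly s) \o expand)) => [c|k] /=.
  by rewrite lrmorphC alg_mpolyC !expandC map_polyC comp_polyC /= lrmorphC alg_mpolyC.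
rewrite expandX; case: (eqVneq k z) => [->|ne_kz].
  by rewrite sz rmorphD /= expandX eqxx wC map_polyX comp_polyX.
by rewrite sC // map_polyC comp_polyC.
Qed.

Lemma expand_const_comm f : expand f = f%:P -> expand (s f) = (s f)%:P.
Proof. by move=> fC; rewrite expand_comm fC map_polyC comp_polyC. Qed.

(** Transforming f = q N + r by s gives another division by N, because translating the main variable
    does not raise the size of the remainder. Uniqueness of the quotient concludes. *)
Lemma quo_comm N : expand N \is monic -> s N = N ->
  forall f, quo N (s f) = s (quo N f).
Proof.
move=> monN sN f; pose s' g := map_poly s g \Po ('X + w%:P).
have [q [r [-> lt_r def_f]]] := quoP monN f.
have -> : s q.['X_z] = (s' q).['X_z].
  by rewrite /s' horner_comp hornerD hornerX hornerC -sz horner_map.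
apply: (quo_unique monN (r := s' r)).
  rewrite /s' size_comp_poly2 ?size_XaddC //.
  exact: leq_ltn_trans (size_poly _ _) lt_r.
have s'D g h : s' (g + h) = s' g + s' h by rewrite /s' /= !rmorphD.
have s'M g h : s' (g * h) = s' g * s' h by rewrite /s' /= !rmorphM.
by rewrite expand_comm def_f -/(s' _) s'D s'M [s' (expand N)]/s' -expand_comm sN.
Qed.

End EquivariantExpansion.

End DivisionByMonic.

(** * The action of the cyclic group *)

Section VariableIndices.

Variables (l : nat) (n : 'I_l -> nat).

Definition blk (k : 'I_(num_vars n)) : 'I_l := tag (enum_val k).
Definition pos (k : 'I_(num_vars n)) : nat := tagged (enum_val k).

Definition var_index (j : 'I_l) (i : 'I_(n j)) : 'I_(num_vars n) :=
  enum_rank (Tagged (fun j => 'I_(n j)) i).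

Lemma blk_var_index j (i : 'I_(n j)) : blk (var_index i) = j.
Proof. by rewrite /blk enum_rankK. Qed.

Lemma pos_var_index j (i : 'I_(n j)) : pos (var_index i) = i.
Proof. by rewrite /pos enum_rankK. Qed.

Variant var_index_spec : 'I_(num_vars n) -> 'I_l -> nat -> Type :=
  VarIndexSpec j (i : 'I_(n j)) : var_index_spec (var_index i) j i.

Lemma var_indexP k : var_index_spec k (blk k) (pos k).
Proof.
rewrite -(enum_valK k); case: (enum_val k) => j i.
by rewrite -/(var_index i) blk_var_index pos_var_index.
Qed.

Lemma blk_pos_inj k k' : blk k = blk k' -> pos k = pos k' -> k = k'.
Proof.
case: (var_indexP k) => j i; case: (var_indexP k') => j' i' eq_j.
by subst j' => /val_inj ->.
Qed.

Lemma pos_lt k : (pos k < n (blk k))%N.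
Proof. by case: var_indexP. Qed.

Lemma exists_var j i : (i < n j)%N -> exists2 k, blk k = j & pos k = i.
Proof.
by move=> lt_i; exists (var_index (Ordinal lt_i)); rewrite ?blk_var_index ?pos_var_index.
Qed.

End VariableIndices.

Section Action.

Variables (K : fieldType) (p : nat) (charKp : p \in [pchar K]).
Variables (gT : finGroupType) (sigma : gT).
Hypotheses (gen_sigma : [set: gT] = <[sigma]>%g) (card_gT : #|gT| = p).
Variables (l : nat) (n : 'I_l -> nat) (n_gt1 : forall j, (1 < n j)%N).
Variable J : jordan_action K n sigma.

Notation S := {mpoly K[num_vars n]}.
Notation R := (inv_ring J).

Let p_pr : prime p := pcharf_prime charKp.

Lemma act_head k : pos k = 0%N -> J sigma 'X_k = 'X_k.
Proof. by case: var_indexP => j i i0; apply: jact_head. Qed.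

Lemma act_next k k' : blk k = blk k' -> pos k = (pos k').+1 ->
  J sigma 'X_k = 'X_k + 'X_k'.
Proof.
case: (var_indexP k) => j i; case: (var_indexP k') => j' i' eq_j.
by subst j'; apply: jact_next.
Qed.

Lemma act_cases k : J sigma 'X_k = 'X_k \/
  exists k', [/\ blk k' = blk k, pos k = (pos k').+1 & J sigma 'X_k = 'X_k + 'X_k'].
Proof.
case def_i: (pos k) => [|i]; first by left; apply: act_head.
right; have [|k' def_j def_k'] := @exists_var _ n (blk k) i.
  by rewrite -ltnS -def_i ltnW // ltnS pos_lt.
by exists k'; rewrite def_k'; split=> //; apply: act_next; rewrite ?def_j ?def_k'.
Qed.

Lemma iter_act i f : iter i (J sigma) f = J (sigma ^+ i)%g f.
Proof.
elim: i => [|i IHi]; first by rewrite expg0 jact1.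
by rewrite iterS IHi expgS jactM.
Qed.

Lemma iter_act_order f : iter p (J sigma) f = f.
Proof.
rewrite iter_act -card_gT -cardsT gen_sigma -[#|_|]/(#[sigma]%g).
by rewrite expg_order jact1.
Qed.

Lemma act_power g : exists i, forall f, J g f = iter i (J sigma) f.
Proof.
have : g \in <[sigma]>%g by rewrite -gen_sigma inE.
by case/cycleP => i ->; exists i => f; rewrite iter_act.
Qed.

Lemma invariant_act f : J sigma f = f -> f \in Defs.invariant J.
Proof.
move=> sf; apply/invariantP => g; have [i ->] := act_power g.
by elim: i => //= i ->.
Qed.

Lemma act_invariant f : f \in Defs.invariant J -> J sigma f = f.
Proof. by move/invariantP. Qed.

Lemma act_inv_val (r : R) : J sigma (inv_val r) = inv_val r.
Proof. exact: act_invariant (valP r). Qed.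

Lemma transferD : {morph transfer p J : f g / f + g}.
Proof.
move=> f g; rewrite /transfer -big_split; apply: eq_bigr => i _.
by rewrite !iter_act raddfD.
Qed.

Lemma transferB f g : transfer p J (f - g) = transfer p J f - transfer p J g.
Proof.
rewrite /transfer -sumrB; apply: eq_bigr => i _.
by rewrite !iter_act raddfB.
Qed.

Lemma transfer_comm (q : S -> S) : {morph q : f g / f + g} ->
  (forall f, q (J sigma f) = J sigma (q f)) ->
  forall f, q (transfer p J f) = transfer p J (q f).
Proof.
move=> qD qs f.
have q0 : q 0 = 0 by apply: (addIr (q 0)); rewrite -qD !add0r.
rewrite /transfer (big_morph q qD q0); apply: eq_bigr => i _.
by elim: (i : nat) => //= e <-; rewrite qs.
Qed.

Lemma act_transfer f : J sigma (transfer p J f) = transfer p J f.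
Proof.
rewrite /transfer raddf_sum /=; move: iter_act_order (prime_gt0 p_pr).
case: p => // p' iter_p _; rewrite big_ord_recr big_ord_recl /= addrC.
by rewrite -iterS iter_p.
Qed.

Lemma transfer_act f : transfer p J (J sigma f) = transfer p J f.
Proof.
rewrite -(transfer_comm (q := J sigma)) ?act_transfer //.
exact: raddfD.
Qed.

Definition top (j : 'I_l) : 'I_(num_vars n) := var_index (last_ord (n_gt1 j)).

Lemma blk_top j : blk (top j) = j. Proof. exact: blk_var_index. Qed.

Lemma pos_top j : pos (top j) = (n j).-1. Proof. exact: pos_var_index. Qed.

Lemma pos_lt_top j k : blk k = j -> k != top j -> (pos k < (n j).-1)%N.
Proof.
move=> blk_k ne_k; have := pos_lt k; rewrite blk_k.
case: (n j) (pos_top j) => [//|m] /= pos_t.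
rewrite ltnS leq_eqVlt => /orP[/eqP pos_k|//].
case/eqP: ne_k; apply: blk_pos_inj; first by rewrite blk_top.
by rewrite pos_t.
Qed.

Lemma act_head_ntop (k : 'I_(num_vars n)) : pos k = 0%N -> forall j, k != top j.
Proof.
move=> pos_k j; apply/eqP => def_k; move: pos_k; rewrite def_k pos_top.
by case: (n j) (n_gt1 j) => [|[]].
Qed.

Lemma act_ntop (k k' : 'I_(num_vars n)) : blk k' = blk k -> pos k = (pos k').+1 ->
  forall j, k' != top j.
Proof.
move=> blk_k' pos_k j; apply/eqP => def_k'.
have := pos_lt k; rewrite pos_k -blk_k' def_k' blk_top pos_top prednK ?ltnn //.
by rewrite ltnW // n_gt1.
Qed.

Lemma expand_ntop j k : k != top j -> expand (top j) 'X_k = ('X_k)%:P :> {poly S}.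
Proof. by move=> ne_k; rewrite expandX (negbTE ne_k). Qed.

Lemma expand_act_ntop j k : k != top j ->
  expand (top j) (J sigma 'X_k) = (J sigma 'X_k)%:P.
Proof.
move=> ne_k; have [->|[k' [blk_k' pos_k ->]]] := act_cases k.
  exact: expand_ntop.
by rewrite rmorphD /= !expand_ntop ?polyCD //; apply: act_ntop pos_k _.
Qed.

Lemma act_top j : exists2 w, J sigma 'X_(top j) = 'X_(top j) + w
  & expand (top j) w = w%:P.
Proof.
have [->|[k' [blk_k' pos_k ->]]] := act_cases (top j).
  by exists 0; rewrite ?addr0 // raddf0.
by exists 'X_k'; rewrite // expand_ntop //; apply: act_ntop pos_k _.
Qed.

Lemma expand_const_act j f : expand (top j) f = f%:P ->
  expand (top j) (J sigma f) = (J sigma f)%:P.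
Proof.
have [w sz wC] := act_top j.
by apply: expand_const_comm sz wC _ _ => k; apply: expand_act_ntop.
Qed.

Lemma expand_const_power j g f : expand (top j) f = f%:P ->
  expand (top j) (J g f) = (J g f)%:P.
Proof.
move=> fC; have [i ->] := act_power g.
by elim: i => //= i; apply: expand_const_act.
Qed.

Definition nrm (j : 'I_l) : S := norm_poly J 'X_(top j).

Lemma act_nrm j : J sigma (nrm j) = nrm j.
Proof. exact/act_invariant/norm_poly_invariant. Qed.

Lemma act_power_top j g : exists2 w, J g 'X_(top j) = 'X_(top j) + w
  & expand (top j) w = w%:P.
Proof.
have [i ->] := act_power g; elim: i => [|i [w def_w wC]].
  by exists 0; rewrite ?addr0 // raddf0.
have [v sz vC] := act_top j; exists (v + J sigma w).
  by rewrite iterS def_w rmorphD /= sz addrA.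
by rewrite rmorphD /= vC expand_const_act // polyCD.
Qed.

Lemma expand_nrm_monic j : expand (top j) (nrm j) \is monic.
Proof.
rewrite /nrm /norm_poly rmorph_prod; apply: monic_prod => g _ /=.
have [w -> wC] := act_power_top j g.
by rewrite rmorphD /= expandX eqxx wC monicXaddC.
Qed.

Lemma expand_nrm j j' : j' != j -> expand (top j) (nrm j') = (nrm j')%:P.
Proof.
move=> ne_j; rewrite /nrm /norm_poly !rmorph_prod; apply: eq_bigr => g _ /=.
apply: expand_const_power; apply: expand_ntop.
by apply: contraNneq ne_j => /(congr1 (@blk _ _)); rewrite !blk_top => ->.
Qed.

Definition quot j : S -> S := quo (top j) (nrm j).

Lemma quotD j : {morph quot j : f g / f + g}.
Proof. exact: quoD (expand_nrm_monic j). Qed.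

Lemma quotMN j f : quot j (nrm j * f) = f.
Proof. exact: quoMN (expand_nrm_monic j) f. Qed.

Lemma quot_const j c f : expand (top j) c = c%:P -> quot j (c * f) = c * quot j f.
Proof. by move=> cC; apply: (quo_const (expand_nrm_monic j)). Qed.

Lemma quotM_nrm j j' f : j' != j -> quot j (nrm j' * f) = nrm j' * quot j f.
Proof. by move=> ne_j; apply/quot_const/expand_nrm. Qed.

Lemma quot_act j f : quot j (J sigma f) = J sigma (quot j f).
Proof.
have [w sz wC] := act_top j.
apply: (quo_comm sz wC) => [k||]; first exact: expand_act_ntop.
  exact: expand_nrm_monic.
exact: act_nrm.
Qed.

Lemma quot_transfer j f : quot j (transfer p J f) = transfer p J (quot j f).
Proof. exact: transfer_comm (@quotD j) (@quot_act j) f. Qed.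

(** [sigma] adds to a variable at most another one of the same block. The lemma serves both the
    total degree and the degree in one block. *)
Lemma act_homog (mf : measure (num_vars n)) :
    (forall k k', blk k = blk k' -> mf U_(k)%MM = mf U_(k')%MM) ->
  forall k, J sigma 'X_k \is (mf U_(k)%MM).-homog for mf.
Proof.
move=> mf_blk k; have [->|[k' [blk_k' _ ->]]] := act_cases k.
  by rewrite dhomogX.
by apply: rpredD; rewrite dhomogX ?(mf_blk _ _ blk_k').
Qed.

Lemma nrm_homog (mf : measure (num_vars n)) j e :
    (forall k k', blk k = blk k' -> mf U_(k)%MM = mf U_(k')%MM) ->
  mf U_(top j)%MM = e -> nrm j \is (e * p)%N.-homog for mf.
Proof.
move=> mf_blk mf_top; rewrite /nrm /norm_poly.
have -> : (e * p = \sum_(g : gT) e)%N by rewrite sum_nat_const card_gT mulnC.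
apply: (big_ind2 (fun u d => u \is d.-homog for mf)).
- exact: dhomog1.
- by move=> u d v d'; apply: dhomogM.
move=> g _; have [i ->] := act_power g.
elim: i => [|i IHi]; first by rewrite dhomogX mf_top.
by rewrite iterS; apply: lrmorph_homog IHi; apply: act_homog.
Qed.

End Action.

(** * Tate cohomology in high degree *)

Section TateCohomology.

Variables (K : fieldType) (p : nat) (charKp : p \in [pchar K]).
Variables (gT : finGroupType) (sigma : gT).
Hypotheses (gen_sigma : [set: gT] = <[sigma]>%g) (card_gT : #|gT| = p).
Variables (l : nat) (n : 'I_l -> nat) (n_gt1 : forall j, (1 < n j)%N).
Variable J : jordan_action K n sigma.

Notation S := {mpoly K[num_vars n]}.
Notation s := (J sigma).
Notation Tr := (transfer p J).

(** * Lifting Tate vanishing from S / (U + x S) to S / U *)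

Section Step.

Variable mf : measure (num_vars n).
Hypothesis mf_blk :
  forall k k', blk k = blk k' -> mf U_(k)%MM = mf U_(k')%MM.

(* Vanishing of the Tate cohomology of S / U in degrees 0 and -1 on the
   component of degree d. *)
Definition tate0_vanish (U : S -> Prop) d : Prop := forall f,
  f \is d.-homog for mf -> U (s f - f) -> exists g, U (f - Tr g).

Definition tate1_vanish (U : S -> Prop) d : Prop := forall f,
  f \is d.-homog for mf -> U (Tr f) -> exists g, U (f - (s g - g)).

Variables (U U' : S -> Prop) (x b : S) (M d0 : nat).
Hypothesis sU : submodule (U : S^o -> Prop).
Hypothesis Us : forall u, U u -> U (s u).
Hypothesis Upr : forall d u, U u -> U (pihomog mf d u).
Hypothesis homx : x \is 1.-homog for mf.
Hypothesis regx : forall f, U (x * f) -> U f.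
Hypothesis invx : U (s x - x).
Hypothesis defU' : forall f, U' f <-> exists g, U (f - x * g).
Hypothesis trb : U (x ^+ M - Tr b).
Hypothesis vanish' : forall d, (d0 <= d)%N -> tate0_vanish U' d /\ tate1_vanish U' d.

Let U0 : U 0 := submodule0 sU.
Let UD u v : U u -> U v -> U (u + v). Proof. exact: submoduleD sU. Qed.
Let UN u : U u -> U (- u). Proof. exact: submoduleN sU. Qed.
Let UB u v : U u -> U v -> U (u - v). Proof. exact: submoduleB sU. Qed.
Let UM a u : U u -> U (a * u). Proof. exact: submoduleZ sU. Qed.
Let Utrans g f h : U (f - g) -> U (g - h) -> U (f - h).
Proof. by move=> fg gh; rewrite -(subrK g f) -addrA; apply: UD. Qed.
Let Usym f g : U (f - g) -> U (g - f).
Proof. by rewrite -[g - f]opprB; apply: UN. Qed.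

Let U_iter i u : U u -> U (iter i s u).
Proof. by move=> Uu; elim: i => //= i; apply: Us. Qed.

Let U_transfer u : U u -> U (Tr u).
Proof.
by move=> Uu; rewrite /transfer; apply: (submodule_sum _ sU) => i _; apply: U_iter.
Qed.

Let U_transferM c h : U (s c - c) -> U (Tr (c * h) - c * Tr h).
Proof.
move=> Uc; rewrite /transfer mulr_sumr -sumrB; apply: (submodule_sum _ sU) => i _.
rewrite !iter_act rmorphM -mulrBl mulrC; apply: UM => /=.
rewrite -iter_act; elim: (i : nat) => [|e IHe] /=; first by rewrite subrr.
by apply: Utrans Uc; rewrite -raddfB; apply: Us.
Qed.

Let pihomog_transfer d f : pihomog mf d (Tr f) = Tr (pihomog mf d f).
Proof.
apply: transfer_comm => [u v|u]; first exact: raddfD.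
by rewrite lrmorph_pihomog //; apply: act_homog.
Qed.

Let pihomog_s d f : pihomog mf d (s f) = s (pihomog mf d f).
Proof. by rewrite lrmorph_pihomog //; apply: act_homog. Qed.

Let hom_xX m d f : f \is d.-homog for mf -> x ^+ m * f \is (m + d).-homog for mf.
Proof. by have := dhomogMn m homx; rewrite mul1n; apply: dhomogM. Qed.

(** If x f = Tr(g) modulo U, then g has transfer 0 modulo U', so g = (s - 1) e + x h modulo U.
    Taking transfers gives x f = x Tr(h), and x is cancelled. *)
Let tate0_cancel d f : (d0 <= d)%N -> f \is d.-homog for mf ->
  (exists g, U (x * f - Tr g)) -> exists g, U (f - Tr g).
Proof.
move=> le_d homf [g Ug]; have homxf := hom_xX 1 homf; rewrite expr1 in homxf.
(* As x has degree 1, g may be replaced by its component of degree d + 1, to which the vanishing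
   modulo U' applies. *)
have {}Ug : U (x * f - Tr (pihomog mf d.+1 g)).
  have := Upr d.+1 Ug; rewrite raddfB /= pihomog_transfer.
  by rewrite [pihomog _ _ (x * f)]pihomog_dE.
set g0 := pihomog mf d.+1 g in Ug.
have [_ /(_ g0 (pihomogP _ _ _))] := vanish' (leqW le_d).
case=> [|e /defU'[h Uh]]; first by apply/defU'; exists f; apply: Usym.
exists h; apply: regx; rewrite mulrBr.
apply: Utrans Ug _; apply: Utrans (U_transferM h invx).
have := U_transfer Uh; rewrite !transferB.
by rewrite (transfer_act charKp gen_sigma card_gT) subrr subr0.
Qed.

(** The same chase with s - 1 and the transfer exchanged: g is invariant modulo U', so g = Tr(e) + x
    h modulo U, and (s - 1) g = x (s - 1) h there. *)
Let tate1_cancel d f : (d0 <= d)%N -> f \is d.-homog for mf ->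
  (exists g, U (x * f - (s g - g))) -> exists g, U (f - (s g - g)).
Proof.
move=> le_d homf [g Ug]; have homxf := hom_xX 1 homf; rewrite expr1 in homxf.
have {}Ug : U (x * f - (s (pihomog mf d.+1 g) - pihomog mf d.+1 g)).
  have := Upr d.+1 Ug; rewrite !raddfB /= pihomog_s.
  by rewrite [pihomog _ _ (x * f)]pihomog_dE.
set g0 := pihomog mf d.+1 g in Ug.
have [/(_ g0 (pihomogP _ _ _)) + _] := vanish' (leqW le_d).
case=> [|e /defU'[h Uh]]; first by apply/defU'; exists f; apply: Usym.
exists h; apply: regx; rewrite mulrBr; apply: Utrans Ug _.
have Uh' := UB (Us Uh) Uh.
rewrite !(raddfB s) /= (act_transfer charKp gen_sigma card_gT) in Uh'.
have -> : s g0 - g0 - x * (s h - h) =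
  s g0 - Tr e - s (x * h) - (g0 - Tr e - x * h) + (s x - x) * s h.
  by rewrite rmorphM /=; ring.
by apply: UD Uh' _; rewrite mulrC; apply: UM.
Qed.

(** As f is invariant modulo U, x^M f = Tr(b) f = Tr(f b) there; the M factors x are then cancelled
    one at a time. *)
Let tate0_step d : (d0 <= d)%N -> tate0_vanish U d.
Proof.
move=> le_d f homf Uf.
have: exists g, U (x ^+ M * f - Tr g).
  exists (f * b); apply: (@Utrans (f * Tr b)); last exact/Usym/U_transferM.
  by rewrite mulrC -mulrBr; apply: UM.
elim: M => [|m IHm]; first by rewrite mul1r.
rewrite exprS -mulrA => Um; apply: IHm.
by apply: (@tate0_cancel (m + d)) (hom_xX m homf) Um; rewrite (leq_trans le_d) ?leq_addl.
Qed.

Let iter_coboundary i f : exists g, iter i s f - f = s g - g.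
Proof.
elim: i => [|i [g IHi]]; first by exists 0; rewrite raddf0 !subrr.
exists (iter i s f + g); rewrite raddfD /= opprD addrACA -IHi.
by rewrite addrA subrK.
Qed.

(* Tr(b) f = b Tr(f) modulo coboundaries, since
   s^i(b) f = s^i(b s^(-i)(f)). *)
Let transfer_mul_coboundary c f : exists g, Tr c * f - c * Tr f = s g - g.
Proof.
have p_gt0 : (0 < p)%N by rewrite prime_gt0 ?(pcharf_prime charKp).
(* Reindexing s(Tr f) = Tr f by i -> p - 1 - i makes s^(p-i) play the role of s^(-i). *)
have -> : c * Tr f = \sum_(i < p) c * iter (p - i) s f.
  rewrite -(act_transfer charKp gen_sigma card_gT J f) /transfer raddf_sum mulr_sumr.
  rewrite (reindex_inj rev_ord_inj) /=; apply: eq_bigr => i _.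
  by rewrite -iterS -subSn // subSS.
rewrite /transfer mulr_suml -sumrB.
apply: (big_ind (fun y => exists g, y = s g - g)) => [|u v [g ->] [h ->]|i _].
- by exists 0; rewrite raddf0 subrr.
- by exists (g + h); rewrite raddfD /= opprD addrACA.
have [g def_g] := iter_coboundary i (c * iter (p - i) s f); exists g.
rewrite -def_g [iter i s (c * _)]iter_act rmorphM /= -!iter_act -iterD subnKC; last exact: ltnW.
by rewrite (iter_act_order gen_sigma card_gT).
Qed.

(** Up to a coboundary, Tr(b) f is b Tr(f), which lies in U. So x^M f is a coboundary modulo U, and
    the factors x are cancelled in turn. *)
Let tate1_step d : (d0 <= d)%N -> tate1_vanish U d.
Proof.
move=> le_d f homf Uf.
have: exists g, U (x ^+ M * f - (s g - g)).
  have [g def_g] := transfer_mul_coboundary b f; exists g; rewrite -def_g opprB.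
  by rewrite addrCA -mulrBl; apply: UD; [apply: UM | rewrite mulrC; apply: UM].
elim: M => [|m IHm]; first by rewrite mul1r.
rewrite exprS -mulrA => Um; apply: IHm.
by apply: (@tate1_cancel (m + d)) (hom_xX m homf) Um; rewrite (leq_trans le_d) ?leq_addl.
Qed.

Lemma tate_step d : (d0 <= d)%N -> tate0_vanish U d /\ tate1_vanish U d.
Proof. by move=> le_d; split; [apply: tate0_step | apply: tate1_step]. Qed.

End Step.

Definition blk_deg (j : 'I_l) (m : 'X_{1..num_vars n}) : nat :=
  \sum_(k | blk k == j) m k.

Fact blk_deg0 j : blk_deg j 0%MM = 0%N.
Proof. by rewrite /blk_deg big1 // => k _; rewrite mnm0E. Qed.

Fact blk_degD j : {morph blk_deg j : m m' / (m + m')%MM >-> (m + m')%N}.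
Proof.
by move=> m m'; rewrite /blk_deg -big_split; apply: eq_bigr => k _; rewrite mnmDE.
Qed.

HB.instance Definition _ j :=
  isMeasure.Build (num_vars n) (blk_deg j) (blk_deg0 j) (blk_degD j).

Lemma blk_degU j k : blk_deg j U_(k)%MM = (blk k == j).
Proof.
rewrite /blk_deg; have [blk_k|nblk_k] := boolP (blk k == j).
  rewrite (bigD1 k) //= mnm1E eqxx big1 // => k' /andP[_ ne_k].
  by rewrite mnm1E eq_sym (negbTE ne_k).
rewrite big1 // => k' blk_k'; rewrite mnm1E.
by case: eqP => // def_k; rewrite def_k blk_k' in nblk_k.
Qed.

Lemma blk_deg_blk j k k' : blk k = blk k' ->
  blk_deg j U_(k)%MM = blk_deg j U_(k')%MM.
Proof. by rewrite !blk_degU => ->. Qed.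

(** * The tower of ideals attached to one block *)

Section Tower.

Variable j : 'I_l.

Notation N := (nrm n_gt1 J j).
Notation z := (top n_gt1 j).

Definition low i : pred 'I_(num_vars n) := fun k => (blk k == j) && (pos k < i)%N.

(** The ideal U_i generated by the first i variables of the block and the norm N: membership is
    divisibility by the image of N once these variables are set to 0. *)
Definition low_ideal i (f : S) : Prop :=
  exists h, kill (low i) f = kill (low i) N * h.

Lemma kill_low_act i f : kill (low i) (s (kill (low i) f)) = kill (low i) (s f).
Proof.
apply: (mpoly_rmorph_ext (f := kill (low i) \o (s \o kill (low i)))
                         (g := kill (low i) \o s)) => [c|k] /=.
  by rewrite /kill substC.
rewrite killX; case: ifP => // low_k; rewrite !raddf0.
have [->|[k' [blk_k' pos_k ->]]] := act_cases J k; first by rewrite killX low_k.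
rewrite raddfD /= !killX low_k add0r; move: low_k; rewrite /low blk_k' pos_k.
by move=> /andP[-> /ltnW->].
Qed.

Lemma kill_lowS i v : blk v = j -> pos v = i ->
  forall f : S, kill (low i.+1) f = kill (pred1 v) (kill (low i) f).
Proof.
move=> blk_v pos_v f; rewrite kill_kill; apply: eq_kill => k /=.
rewrite /low; case: (eqVneq k v) => [->|ne_kv] /=.
  by rewrite blk_v eqxx pos_v ltnSn.
have [blk_k|//] := eqVneq (blk k) j; rewrite /= ltnS leq_eqVlt.
case: eqP => // pos_k; case/eqP: ne_kv.
by apply: blk_pos_inj; rewrite ?blk_v ?pos_v.
Qed.

(** Modulo the other variables of its block, z is fixed by the group, so all p factors of the norm
    become z. *)
Lemma kill_low_nrm : kill (low (n j).-1) N = 'X_z ^+ p.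
Proof.
have low_z : low (n j).-1 z = false by rewrite /low pos_top ltnn andbF.
rewrite /nrm /norm_poly rmorph_prod -card_gT -prodr_const.
rewrite [RHS](eq_bigl xpredT); last by move=> g; rewrite inE.
apply: eq_bigr => g _; have [i ->] := act_power gen_sigma J g.
elim: i => [|i IHi] /=; first by rewrite killX low_z.
rewrite -kill_low_act IHi; have [->|[k' [blk_k' pos_z ->]]] := act_cases J z.
  by rewrite killX low_z.
rewrite raddfD /= !killX low_z /low blk_k' blk_top eqxx -(pos_top n_gt1).
by rewrite pos_z ltnSn addr0.
Qed.

Lemma kill_low_nrm_neq0 i : (i <= (n j).-1)%N -> kill (low i) N != 0.
Proof.
move=> le_i; apply/eqP => N0.
have : kill (low (n j).-1) (kill (low i) N) = 0 by rewrite N0 raddf0.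
rewrite kill_kill => /eqP; rewrite (eq_kill (Q := low (n j).-1)).
  by rewrite kill_low_nrm expf_eq0 (negbTE (mpolyX_neq0 _ _)) andbF.
move=> k; rewrite /= /low; case: (blk k == j) => //=.
by apply/orb_idr => /leq_trans; apply.
Qed.

Lemma low_ideal_submodule i : submodule (low_ideal i : S^o -> Prop).
Proof.
split=> [|u v [h def_u] [h' def_v]|a u [h def_u]].
- by exists 0; rewrite raddf0 mulr0.
- by exists (h + h'); rewrite raddfD /= def_u def_v mulrDr.
- by exists (kill (low i) a * h); rewrite rmorphM /= def_u mulrCA.
Qed.

Lemma low_ideal_act i u : low_ideal i u -> low_ideal i (s u).
Proof.
case=> h def_u; exists (kill (low i) (s h)).
rewrite -kill_low_act def_u !rmorphM /= kill_low_act.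
by rewrite act_nrm.
Qed.

Lemma kill_homog (mf : measure (num_vars n)) P k :
  kill (K := K) P 'X_k \is (mf U_(k)%MM).-homog for mf.
Proof. by rewrite killX; case: ifP; rewrite ?dhomog0 ?dhomogX. Qed.

Lemma nrm_blk_homog : N \is p.-homog for (blk_deg j).
Proof.
rewrite -[p]mul1n; apply: (nrm_homog gen_sigma card_gT) => [k k'|].
  exact: blk_deg_blk.
by rewrite /= blk_degU blk_top eqxx.
Qed.

Lemma low_ideal_pihomog i d u :
  low_ideal i u -> low_ideal i (pihomog (blk_deg j) d u).
Proof.
case=> h def_u.
have homN : kill (low i) N \is p.-homog for (blk_deg j).
  by apply: lrmorph_homog nrm_blk_homog; apply: kill_homog.
have := lrmorph_pihomog (s := kill (low i)) (@kill_homog (blk_deg j) _) d u.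
rewrite /low_ideal /= => ->; rewrite def_u (pihomogM _ _ homN).
by case: ifP => _; [exists (pihomog (blk_deg j) (d - p) h) | exists 0; rewrite mulr0].
Qed.

(** A monomial not killed involves no variable of the block except z, hence contains z^d, a multiple
    of z^p. *)
Lemma low_ideal_full d f : (p <= d)%N -> f \is d.-homog for (blk_deg j) ->
  low_ideal (n j).-1 f.
Proof.
move=> le_pd homf; rewrite [f]mpolyE big_seq.
apply: (submodule_sum _ (low_ideal_submodule _)) => m /(dhomog_mf homf) deg_m.
rewrite -mul_mpolyC; apply: (submoduleZ _ (low_ideal_submodule _)).
rewrite /low_ideal kill_low_nrm /kill substXm.
have [/existsP[k /andP[low_k mk]]|] :=
    boolP [exists k, low (n j).-1 k && (m k != 0%N)].
  by exists 0; rewrite mulr0 (bigD1 k) //= low_k expr0n (negbTE mk) mul0r.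
rewrite negb_exists => /forallP low_m.
have deg_z : m z = d.
  rewrite -deg_m /= /blk_deg (bigD1 z) /= ?blk_top //.
  rewrite big1 ?addn0 // => k /andP[/eqP blk_k ne_k].
  have := low_m k; rewrite /low blk_k eqxx (pos_lt_top blk_k ne_k) /= negbK.
  by move/eqP.
rewrite (bigD1 z) //= /low pos_top ltnn andbF deg_z -(subnKC le_pd) exprD -mulrA.
by eexists.
Qed.

(** In a relation x_v f = N h modulo the low variables, setting x_v = 0 leaves N h = 0 with N still
    nonzero. So x_v divides h and can be cancelled. *)
Lemma low_ideal_cancel i v f : blk v = j -> pos v = i -> (i < (n j).-1)%N ->
  low_ideal i ('X_v * f) -> low_ideal i f.
Proof.
move=> blk_v pos_v lt_i [h def_f].
have low_v : low i v = false by rewrite /low pos_v ltnn andbF.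
rewrite rmorphM /= killX low_v in def_f.
have := congr1 (kill (pred1 v)) def_f; rewrite !rmorphM /= killX /= eqxx mul0r.
rewrite -(kill_lowS blk_v pos_v) => /esym/eqP.
rewrite mulf_eq0 (negbTE (kill_low_nrm_neq0 _)) //= => /eqP/kill1_eq0[g def_h].
exists g; apply: (mulfI (mpolyX_neq0 K U_(v))).
by rewrite def_f def_h mulrCA.
Qed.

Lemma low_idealS i v f : blk v = j -> pos v = i ->
  low_ideal i.+1 f <-> exists g, low_ideal i (f - 'X_v * g).
Proof.
move=> blk_v pos_v.
have low_v : low i v = false by rewrite /low pos_v ltnn andbF.
have killK (P : pred 'I_(num_vars n)) (g : S) : kill P (kill P g) = kill P g.
  by rewrite kill_kill; apply: eq_kill => k /=; rewrite orbb.
split=> [[h def_f]|[g [h def_f]]].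
  have {}def_f : kill (low i.+1) f = kill (low i.+1) N * kill (low i.+1) h.
    by rewrite -[LHS]killK def_f rmorphM /= killK.
  have /kill1_eq0[g def_g] :
      kill (pred1 v) (kill (low i) f - kill (low i) N * kill (low i) h) = 0.
    by rewrite raddfB /= rmorphM /= -!(kill_lowS blk_v pos_v) def_f subrr.
  exists g; exists (kill (low i) h).
  have := congr1 (kill (low i)) def_g.
  rewrite raddfB /= !rmorphM /= !killK killX low_v raddfB /= rmorphM /= killX low_v.
  by move=> <-; rewrite opprB addrC subrK.
exists (kill (pred1 v) h); rewrite !(kill_lowS blk_v pos_v) -rmorphM -def_f.
rewrite raddfB /= rmorphM /= raddfB /= rmorphM /= killX low_v killX /= eqxx mul0r.
by rewrite subr0.
Qed.

Lemma kill_low_act_next i v : blk v = j -> pos v = i ->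
  kill (low i) (s 'X_v) = 'X_v.
Proof.
move=> blk_v pos_v.
have low_v : low i v = false by rewrite /low pos_v ltnn andbF.
have [->|[k' [blk_k' pos_k' ->]]] := act_cases J v; first by rewrite killX low_v.
by rewrite raddfD /= !killX low_v /low blk_k' blk_v eqxx -pos_v pos_k' ltnSn addr0.
Qed.

Lemma low_ideal_invariant i v : blk v = j -> pos v = i ->
  low_ideal i (s 'X_v - 'X_v).
Proof.
move=> blk_v pos_v; exists 0; rewrite mulr0 raddfB /= kill_low_act_next //.
by rewrite killX /low pos_v ltnn andbF subrr.
Qed.

(** Modulo the low variables, s^e sends x_v' to x_v' + e x_v, so the transfer becomes a sum over
    translates. *)
Lemma low_ideal_transfer i v v' : blk v = j -> pos v = i ->
    blk v' = j -> pos v' = i.+1 ->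
  low_ideal i ('X_v ^+ p.-1 - Tr (- 'X_v' ^+ p.-1)).
Proof.
move=> blk_v pos_v blk_v' pos_v'; exists 0; rewrite mulr0.
have low_v : low i v = false by rewrite /low pos_v ltnn andbF.
have low_v' : low i v' = false by rewrite /low pos_v' ltnNge leqnSn andbF.
have kill_iter e : kill (low i) (iter e s 'X_v') = 'X_v' + 'X_v *+ e.
  elim: e => [|e IHe] /=; first by rewrite killX low_v' addr0.
  rewrite -kill_low_act IHe (raddfD s) (raddfMn s) /=.
  rewrite (@act_next _ _ _ _ _ J v' v) ?blk_v ?pos_v //.
  rewrite !raddfD raddfMn /= kill_low_act_next // !killX low_v low_v'.
  by rewrite -addrA mulrS.
rewrite raddfB /= rmorphXn /= killX low_v /transfer (raddf_sum (kill (low i))) /=.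
rewrite (eq_bigr (fun e : 'I_p => - ('X_v' + 'X_v *+ e) ^+ p.-1)) => [|e _].
  by rewrite sumrN (sum_translates_pred charKp) !opprK subrr.
by rewrite iter_act !raddfN /= !rmorphXn /= -iter_act kill_iter.
Qed.

(** Descending induction on i. At i = n_j - 1 the whole component lies in the ideal; each step
    adjoins the variable at position i, whose power p - 1 is a transfer. *)
Lemma low_ideal_vanish i d : (i <= (n j).-1)%N -> (p <= d)%N ->
  tate0_vanish (blk_deg j) (low_ideal i) d /\
  tate1_vanish (blk_deg j) (low_ideal i) d.
Proof.
move=> le_i; rewrite -(subKn le_i); move: (_ - i)%N (leq_subr i (n j).-1) => e.
elim: e d => [d _|e IHe d lt_e] le_pd.
  have full := low_ideal_full le_pd.
  rewrite subn0; split=> f homf _; exists 0; last by rewrite raddf0 !subr0; apply: full.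
  by rewrite /transfer big1 ?subr0 => [|e _]; [apply: full | rewrite iter_act raddf0].
have [v blk_v pos_v] : exists2 v : 'I_(num_vars n), blk v = j & pos v = ((n j).-1 - e.+1)%N.
  apply: exists_var; rewrite (leq_ltn_trans (leq_subr _ _)) // prednK //.
  exact: ltnW (n_gt1 j).
have lt_v : (pos v < (n j).-1)%N by rewrite pos_v -subSn // subSS leq_subr.
have [v' blk_v' pos_v'] : exists2 v' : 'I_(num_vars n), blk v' = j & pos v' = (pos v).+1.
  by apply: exists_var; rewrite -ltnS in lt_v; apply: leq_trans lt_v _; case: (n j) (n_gt1 j).
rewrite -pos_v.
apply: (@tate_step (blk_deg j) _ (low_ideal (pos v)) (low_ideal (pos v).+1) 'X_v
          (- 'X_v' ^+ p.-1) p.-1 p) => //.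
- exact: blk_deg_blk.
- exact: low_ideal_submodule.
- exact: low_ideal_act.
- exact: low_ideal_pihomog.
- by rewrite dhomogX /= blk_degU blk_v eqxx.
- by move=> f; apply: low_ideal_cancel.
- exact: low_ideal_invariant.
- by move=> f; apply: low_idealS.
- exact: low_ideal_transfer.
- move=> d' le_pd'; have -> : ((pos v).+1 = (n j).-1 - e)%N by rewrite pos_v -subSn // subSS.
  by apply: IHe => //; apply: ltnW.
Qed.

(** At the bottom of the tower the ideal is (N), so f = Tr(g) + N h. The cofactor h is invariant
    because N h is and N is a nonzero invariant. *)
Lemma invariant_blk_homog d f : s f = f -> (p <= d)%N ->
    f \is d.-homog for (blk_deg j) ->
  exists g h, s h = h /\ f = Tr g + N * h.
Proof.
move=> sf le_pd homf.
have [/(_ f homf) + _] := low_ideal_vanish (leq0n _) le_pd.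
have low0 (u : S) : kill (low 0) u = u.
  by rewrite (eq_kill (Q := pred0)) ?kill_pred0 // => k; rewrite /low ltn0 andbF.
case=> [|g [h]]; first by exists 0; rewrite sf subrr raddf0 mulr0.
rewrite !low0 => /eqP; rewrite subr_eq addrC => /eqP def_f.
exists g, h; split=> //.
apply: (mulfI (x := N)); first by have := kill_low_nrm_neq0 (leq0n _); rewrite low0.
rewrite -[N in LHS](act_nrm n_gt1 J j) -rmorphM /=.
apply: (addrI (Tr g)); rewrite -{1}(act_transfer charKp gen_sigma card_gT J g).
by rewrite -raddfD /= -def_f.
Qed.

End Tower.

End TateCohomology.

(** * Invariants of large degree *)

Section HighDegreeInvariants.

Variables (K : fieldType) (p : nat) (charKp : p \in [pchar K]).
Variables (gT : finGroupType) (sigma : gT).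
Hypotheses (gen_sigma : [set: gT] = <[sigma]>%g) (card_gT : #|gT| = p).
Variables (l : nat) (n : 'I_l -> nat) (n_gt1 : forall j, (1 < n j)%N).
Variable J : jordan_action K n sigma.

Notation S := {mpoly K[num_vars n]}.
Notation s := (J sigma).
Notation Tr := (transfer p J).

Lemma act_pihomog (mf : measure (num_vars n)) d f :
    (forall k k', blk k = blk k' -> mf U_(k)%MM = mf U_(k')%MM) ->
  s f = f -> s (pihomog mf d f) = pihomog mf d f.
Proof. by move=> mf_blk sf; rewrite lrmorph_pihomog ?sf //; apply: act_homog. Qed.

(** Only the components of degree at least p in the block are rewritten. The remainder f' is a part
    of f with unchanged coefficients, so bounds already reached in other blocks persist. *)
Lemma invariant_reduce j f : s f = f -> exists f' g h, [/\ s f' = f', s h = h,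
  f = f' + (Tr g + nrm n_gt1 J j * h)
  & forall m, f'@_m = if (blk_deg j m < p)%N then f@_m else 0].
Proof.
move=> sf; pose k := maxn (mmeasure (blk_deg j) f) p.
have le_pk : (p <= k)%N by rewrite leq_maxr.
pose c e := pihomog (blk_deg j) e f.
have sc e : s (c e) = c e by apply: act_pihomog => //; apply: blk_deg_blk.
have def_f : f = \sum_(e < k) c e.
  exact: (@pihomog_partitionE _ _ (blk_deg j)) (leq_maxl _ _).
exists (\sum_(e < k | (e < p)%N) c e).
have [g [h [sh def_gh]]] : exists g h, s h = h /\
    \sum_(e < k | ~~ (e < p)%N) c e = Tr g + nrm n_gt1 J j * h.
  apply: (big_ind (fun u => exists g h, s h = h /\ u = Tr g + nrm n_gt1 J j * h)).
  - by exists 0, 0; rewrite raddf0 mulr0 addr0 /transfer big1 // => e _;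
      rewrite iter_act raddf0.
  - move=> u v [g [h [sh ->]]] [g' [h' [sh' ->]]]; exists (g + g'), (h + h').
    by rewrite raddfD /= sh sh' transferD mulrDr addrACA.
  - move=> e; rewrite -leqNgt => le_pe.
    by apply: (invariant_blk_homog charKp gen_sigma card_gT n_gt1 (sc e) le_pe);
      apply: pihomogP.
exists g, h; split=> //.
- by rewrite raddf_sum; apply: eq_bigr => e _; apply: sc.
- by rewrite -def_gh {1}def_f (bigID (fun e : 'I_k => (e < p)%N)).
move=> m; rewrite raddf_sum /=.
under eq_bigr do rewrite mcoeff_pihomog.
case: ifP => lt_m.
  have lt_mk : (blk_deg j m < k)%N by apply: leq_trans lt_m le_pk.
  rewrite (bigD1 (Ordinal lt_mk)) //= eqxx big1 ?addr0 // => e /andP[_ ne_e].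
  case: eqP => // def_m; case/eqP: ne_e.
  by apply: val_inj.
by apply: big1 => e lt_e; case: eqP => // def_m; rewrite def_m lt_e in lt_m.
Qed.

Lemma mdeg_blk_deg (m : 'X_{1..num_vars n}) : mdeg m = (\sum_j blk_deg j m)%N.
Proof.
by rewrite mdegE (partition_big (@blk l n) predT).
Qed.

(** After reduction in every block, a monomial left over would have degree at most l p, less than d,
    so the remainder is 0. Passing to components of degree d makes the cofactors homogeneous. *)
Lemma high_degree_invariant d f : s f = f -> f \is d.-homog -> (l * p < d)%N ->
  exists g (h : 'I_l -> S), (forall j, s (h j) = h j /\ h j \is (d - p).-homog) /\
    f = Tr g + \sum_j nrm n_gt1 J j * h j.
Proof.
move=> sf homf lt_d.
have reduce (r : seq 'I_l) : exists f' g (h : 'I_l -> S), [/\ s f' = f',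
    forall j, s (h j) = h j, f = f' + (Tr g + \sum_j nrm n_gt1 J j * h j)
  & forall m, f'@_m != 0 -> f@_m != 0 /\ forall j, j \in r -> (blk_deg j m < p)%N].
  elim: r => [|j r [f' [g [h [sf' sh def_f f'm]]]]].
    exists f, 0, (fun=> 0); split=> [//|j||m fm].
    - by rewrite raddf0.
    - rewrite big1 => [|j _]; last by rewrite mulr0.
      by rewrite /transfer big1 ?addr0 // => e _; rewrite iter_act raddf0.
    - by split.
  have [f2 [g2 [h2 [sf2 sh2 def_f' f2m]]]] := invariant_reduce j sf'.
  exists f2, (g + g2), (fun j' => h j' + (if j' == j then h2 else 0)); split=> //.
  - by move=> j'; rewrite raddfD /= sh; case: ifP; rewrite ?sh2 ?raddf0.
  - rewrite {1}def_f {1}def_f' transferD -!addrA; congr (_ + _).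
    under [in RHS]eq_bigr do rewrite mulrDr.
    rewrite big_split /= [X in _ = _ + (_ + (_ + X))](bigD1 j) //= eqxx [\sum_(_ < _ | _ != _) _]big1.
      by rewrite addr0; ring.
    by move=> j' /negbTE ->; rewrite mulr0.
  - move=> m; rewrite f2m; case: ifP => [lt_m /f'm[fm lt_r]|]; last by rewrite eqxx.
    by split=> // j'; rewrite inE => /orP[/eqP->|/lt_r].
have [f' [g [h [_ sh def_f f'm]]]] := reduce (enum 'I_l).
have {f'm} f'0 : f' = 0.
  apply/mpolyP => m; rewrite mcoeff0; apply/eqP/negPn/negP => /f'm[fm lt_m].
  move: lt_d; rewrite ltnNge => /negP[].
  have <- : mdeg m = d.
    by apply/eqP; apply: contraR fm => ne_d; apply/eqP/(dhomog_nemf_coeff homf).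
  rewrite mdeg_blk_deg -[l in (l * _)%N]card_ord -sum_nat_const.
  by apply: leq_sum => j _; rewrite ltnW // lt_m ?mem_enum.
rewrite f'0 add0r in def_f.
exists (pihomog mdeg d g), (fun j => pihomog mdeg (d - p) (h j)); split=> [j|].
  split; last exact: pihomogP.
  by apply: act_pihomog => // k k' _; rewrite /= !mdeg1.
rewrite -[LHS](pihomog_dE homf) {1}def_f raddfD /=; congr (_ + _).
  apply: (@transfer_comm _ p _ _ _ _ J (pihomog mdeg d)) => [u v|u]; first exact: raddfD.
  rewrite lrmorph_pihomog //; apply: act_homog => k k' _.
  by rewrite /= !mdeg1.
rewrite (linear_sum (pihomog mdeg d)); apply: eq_bigr => j _ /=; rewrite (@pihomogM _ _ _ _ _ p).
  rewrite ifT // (leq_trans _ (ltnW lt_d)) //.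
  by rewrite -{1}[p]mul1n leq_mul2r (leq_ltn_trans (leq0n j)) ?orbT.
rewrite -[p]mul1n; apply: (nrm_homog gen_sigma card_gT) => [k k' _|].
  by rewrite /= !mdeg1.
by rewrite /= mdeg1.
Qed.

End HighDegreeInvariants.

(** * Membership in R / I tested on representatives *)

Section IdealQuotient.

Variables (R : comNzRingType) (I : idealr R).

Notation Q := {ideal_quot I}.

Lemma pi_eq r r' : (\pi_Q r = \pi_Q r') <-> r - r' \in I.
Proof. by rewrite Quotient.idealrBE; split=> /eqP. Qed.

Lemma pi_eq0 r : (\pi_Q r = 0) <-> r \in I.
Proof. by rewrite -(rmorph0 (\pi_Q)) pi_eq subr0. Qed.

Lemma pi_initial_submod k (a : 'I_k -> R) i r :
  in_initial_submod (M := Q^o) (fun j => \pi_Q (a j)) i (\pi_Q r) <->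
  exists2 t, t \in I & in_initial_submod (M := R^o) a i (r - t).
Proof.
split=> [[c def_r]|[t tI [c def_r]]].
  pose d j : R^o := generic_quotient.repr (c j : Q).
  exists (r - \sum_(j < k | (j < i)%N) a j *: d j); last first.
    by rewrite opprB addrCA subrr addr0; exists d.
  apply/pi_eq; rewrite def_r rmorph_sum; apply: eq_bigr => j _.
  have -> : c j = \pi_Q (d j) by rewrite /d reprK.
  exact: (esym (rmorphM (\pi_Q) (a j) (d j))).
exists (fun j => \pi_Q (c j)).
have -> : \pi_Q r = \pi_Q (r - t) by apply/pi_eq; rewrite opprB addrCA subrr addr0.
rewrite def_r rmorph_sum; apply: eq_bigr => j _.
exact: (rmorphM (\pi_Q) (a j) (c j)).
Qed.

End IdealQuotient.

(** * Depth of the transfer ideal and of its quotient *)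

Section TransferDepth.

Variables (K : fieldType) (p : nat) (charKp : p \in [pchar K]).
Variables (gT : finGroupType) (sigma : gT).
Hypotheses (gen_sigma : [set: gT] = <[sigma]>%g) (card_gT : #|gT| = p).
Variables (l : nat) (l_gt0 : (0 < l)%N).
Variables (n : 'I_l -> nat) (n_gt1 : forall j, (1 < n j)%N).
Variable J : jordan_action K n sigma.

Notation S := {mpoly K[num_vars n]}.
Notation R := (inv_ring J).
Notation I := (transfer_ideal J charKp : idealr R).
Notation Q := {ideal_quot I}.

Definition invnorm (j : 'I_l) : R := norm J (xvar K (last_ord (n_gt1 j))).

Lemma inv_val_invnorm j : inv_val (invnorm j) = nrm n_gt1 J j.
Proof. by []. Qed.

Lemma inv_val_inj : injective (@inv_val _ _ _ _ _ J).
Proof. exact: val_inj. Qed.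

Lemma inv_valD (r r' : R) : inv_val (r + r') = inv_val r + inv_val r'.
Proof. by []. Qed.

Lemma inv_valM (r r' : R) : inv_val (r * r') = inv_val r * inv_val r'.
Proof. by []. Qed.

Lemma inv_valB (r r' : R) : inv_val (r - r') = inv_val r - inv_val r'.
Proof. exact: (raddfB (\val : R -> S)). Qed.

Lemma inv_val_sum (T : Type) (e : seq T) (P : pred T) (F : T -> R) :
  inv_val (\sum_(i <- e | P i) F i) = \sum_(i <- e | P i) inv_val (F i).
Proof. exact: (raddf_sum (\val : R -> S)). Qed.

Lemma transfer_idealP (r : R) :
  reflect (exists f, transfer p J f = inv_val r) (r \in I).
Proof. exact: asboolP. Qed.

Lemma inv_homogM d e (r r' : R) :
  inv_deg J d r -> inv_deg J e r' -> inv_deg J (d + e) (r * r').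
Proof. exact: dhomogM. Qed.

Lemma invnorm_homog j : inv_deg J p (invnorm j).
Proof.
rewrite /inv_deg inv_val_invnorm -[p]mul1n.
by apply: (nrm_homog gen_sigma card_gT) => [k k' _|] /=; rewrite !mdeg1.
Qed.

Fact inv_quot_subproof j (r : R) : quot n_gt1 J j (inv_val r) \in Defs.invariant J.
Proof.
apply: (invariant_act gen_sigma).
by rewrite -(quot_act gen_sigma) act_inv_val.
Qed.

Definition inv_quot j (r : R) : R := InvRing (inv_quot_subproof j r).

Lemma inv_quotD j : {morph inv_quot j : r r' / r + r'}.
Proof. by move=> r r'; apply: inv_val_inj; apply: quotD. Qed.

Lemma inv_quotMN j r : inv_quot j (invnorm j * r) = r.
Proof. by apply: inv_val_inj; apply: quotMN. Qed.

Lemma inv_quotM_invnorm j j' r :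
  j' != j -> inv_quot j (invnorm j' * r) = invnorm j' * inv_quot j r.
Proof. by move=> ne_j; apply: inv_val_inj; apply: quotM_nrm. Qed.

Lemma inv_quot_transfer_ideal j r : r \in I -> inv_quot j r \in I.
Proof.
move=> /transfer_idealP[f def_r]; apply/transfer_idealP; exists (quot n_gt1 J j f).
by rewrite -(quot_transfer p gen_sigma) def_r.
Qed.

Fact head_var_subproof : xvar K (Ordinal (ltnW (n_gt1 (Ordinal l_gt0)))) \in Defs.invariant J.
Proof. by apply: (invariant_act gen_sigma); apply: jact_head. Qed.

Definition head_var : R := InvRing head_var_subproof.

Lemma head_var_homog : inv_deg J 1 head_var.
Proof. by rewrite /inv_deg /= dhomogX /= mdeg1. Qed.

Lemma inv_quotM_head_var j r :
  inv_quot j (head_var * r) = head_var * inv_quot j r.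
Proof.
apply: inv_val_inj; apply: (quot_const gen_sigma); apply: expand_ntop.
by apply: act_head_ntop; rewrite pos_var_index.
Qed.

(** The norms come first and x_(1, 1) last, since only the earlier terms of the sequence must have
    left inverses. *)
Definition norms_head_var (i : 'I_l.+1) : R :=
  oapp invnorm head_var (unlift ord_max i).

Lemma norms_head_var_regular (M : lmodType R) (q : 'I_l -> M -> M) :
    (forall j, {morph q j : u v / u + v}) ->
    (forall j m, q j (invnorm j *: m) = m) ->
    (forall j j' m, j' != j -> q j (invnorm j' *: m) = invnorm j' *: q j m) ->
    (forall j m, q j (head_var *: m) = head_var *: q j m) ->
    (forall r (m : M), r != 0 -> r *: m = 0 -> m = 0) ->
  regular_seq (inv_deg J) M norms_head_var.
Proof.
move=> qD qN qC qx torsion_free; split=> [i|i m].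
  rewrite /norms_head_var; case: unliftP => [j|] _ /=.
    by exists p; [rewrite prime_gt0 // (pcharf_prime charKp) | apply: invnorm_homog].
  by exists 1%N; last exact: head_var_homog.
(* The identity at the last index is a mere default: left inverses are required only at indices
   below another one. *)
pose q' (i : 'I_l.+1) := oapp q id (unlift ord_max i).
have lt_max (j i' : 'I_l.+1) : (j < i')%N -> exists2 j', j = lift ord_max j' & True.
  move=> lt_j; case: (unliftP ord_max j) => [j' ->|def_j]; first by exists j'.
  by move: lt_j; rewrite def_j ltnNge leq_ord.
apply: (regular_initial_projector (q := q')) => [j|j|j j'|u].
- by move=> /lt_max[j' -> _]; rewrite /q' liftK; apply: qD.
- by move=> /lt_max[j' -> _] u; rewrite /q' /norms_head_var liftK; apply: qN.
- move=> /lt_max[k -> _] ne_j u; rewrite /q' /norms_head_var liftK /=.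
  case: unliftP ne_j => [k' ->|-> _] /=; last exact: qx.
  by move=> ne_k; apply: qC; apply: contraNneq ne_k => ->.
apply: torsion_free; rewrite /norms_head_var; case: unliftP => [j|] _ /=.
  apply/eqP => /(congr1 (@inv_val _ _ _ _ _ J)); rewrite inv_val_invnorm => N0.
  have := expand_nrm_monic gen_sigma n_gt1 J j.
  by rewrite N0 raddf0 => /monic_neq0; rewrite eqxx.
apply/eqP => /(congr1 (@inv_val _ _ _ _ _ J)) /eqP.
by rewrite (negbTE (mpolyX_neq0 K _)).
Qed.

Lemma inv_ring_regular : regular_seq (inv_deg J) R^o norms_head_var.
Proof.
apply: (@norms_head_var_regular R^o inv_quot).
- exact: inv_quotD.
- exact: inv_quotMN.
- by move=> j j' r; apply: inv_quotM_invnorm.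
- exact: inv_quotM_head_var.
move=> r m r0 /(congr1 (@inv_val _ _ _ _ _ J)) /eqP.
rewrite -[r *: m]/(r * m) inv_valM mulf_eq0 => /orP[/eqP|/eqP] val0.
  by case/eqP: r0; apply: inv_val_inj.
exact: inv_val_inj.
Qed.

Lemma transfer_ideal_regular :
  regular_seq (inv_deg J) (ideal_module I) norms_head_var.
Proof.
pose q j (m : ideal_module I) : ideal_module I :=
  IdealModule (inv_quot_transfer_ideal j (ideal_valP m)).
apply: (@norms_head_var_regular _ q).
- by move=> j u v; apply: ideal_val_inj; apply: inv_quotD.
- by move=> j u; apply: ideal_val_inj; apply: inv_quotMN.
- by move=> j j' u ne_j; apply: ideal_val_inj; apply: inv_quotM_invnorm.
- by move=> j u; apply: ideal_val_inj; apply: inv_quotM_head_var.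
move=> r m r0 /(congr1 (@ideal_val _ I)) /(congr1 (@inv_val _ _ _ _ _ J)) /eqP.
rewrite ideal_valZ ideal_val0 inv_valM mulf_eq0 => /orP[/eqP|/eqP] val0.
  by case/eqP: r0; apply: inv_val_inj.
by apply/ideal_val_inj/inv_val_inj.
Qed.

Definition in_transfer_norms i (r : R) : Prop :=
  exists2 t, t \in I & in_initial_submod (M := R^o) invnorm i (r - t).

Lemma transfer_norms_regular (i : 'I_l) r :
  in_transfer_norms i (invnorm i * r) -> in_transfer_norms i r.
Proof.
apply: (regular_left_inverse (M := R^o) (U := fun r => r \in I) (q := inv_quot i)).
- exact: inv_quotD.
- exact: inv_quotMN.
- by move=> j lt_ji m; apply: inv_quotM_invnorm; rewrite -val_eqE /= ltn_eqF.
- exact: inv_quot_transfer_ideal.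
Qed.

Lemma high_degree_transfer_norms d (r : R) : inv_deg J d r -> (l * p < d)%N ->
  exists h : 'I_l -> R, (forall j, inv_deg J (d - p) (h j)) /\
    r - \sum_j invnorm j * h j \in I.
Proof.
move=> homr lt_d.
have [g [h [hP def_r]]] := high_degree_invariant charKp gen_sigma card_gT n_gt1
  (act_inv_val r) homr lt_d.
have hI j : h j \in Defs.invariant J.
  by apply: (invariant_act gen_sigma); case: (hP j).
exists (fun j => InvRing (hI j)); split=> [j|]; first by case: (hP j).
apply/transfer_idealP; exists g.
by rewrite inv_valB inv_val_sum def_r addrK.
Qed.

Lemma in_transfer_norms_high d (r : R) :
  inv_deg J d r -> (l * p < d)%N -> in_transfer_norms l r.
Proof.
move=> homr lt_d; have [h [_ rI]] := high_degree_transfer_norms homr lt_d.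
exists (r - \sum_j invnorm j * h j) => //; rewrite opprB addrCA subrr addr0.
by exists h; apply: eq_bigl => j; rewrite ltn_ord.
Qed.

(** Transfers and multiples of the norms have constant coefficient 0. *)
Lemma transfer_norms_proper : ~ in_transfer_norms l 1.
Proof.
case=> t /transfer_idealP[f def_t] [c] /(congr1 (@inv_val _ _ _ _ _ J)).
rewrite inv_valB inv_val_sum -def_t => /(congr1 (mcoeff 0%MM)).
rewrite mcoeffB (transfer_const_coeff charKp) mcoeff1 eqxx subr0 raddf_sum big1 /=.
  by move/eqP; rewrite oner_eq0.
move=> j _; rewrite [X in mcoeff _ X](inv_valM (invnorm j) (c j)) rmorphM /=.
rewrite (dhomog_nemf_coeff (invnorm_homog j)) ?mul0r //= mdeg0.
by rewrite eq_sym -lt0n prime_gt0 // (pcharf_prime charKp).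
Qed.

(** Choose u homogeneous of the largest degree outside the ideal, a degree bounded by l p: a factor
    of positive degree pushes it beyond that maximum. *)
Lemma transfer_norms_socle : exists u, ~ in_transfer_norms l u /\
  forall d y, (0 < d)%N -> inv_deg J d y -> in_transfer_norms l (y * u).
Proof.
pose P d := `[< exists2 u, inv_deg J d u & ~ in_transfer_norms l u >].
have exP : exists d, P d.
  exists 0%N; apply/asboolP; exists 1; last exact: transfer_norms_proper.
  exact: dhomog1.
have leP d : P d -> (d <= l * p)%N.
  move=> /asboolP[u homu uN]; rewrite leqNgt; apply/negP => lt_d.
  exact/uN/(in_transfer_norms_high homu).
have [d /asboolP[u homu uN] maxd] := ex_maxnP exP leP.
exists u; split=> // e y e_gt0 homy; apply: contrapT => yuN.
have /maxd : P (e + d)%N.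
  by apply/asboolP; exists (y * u) => //; apply: inv_homogM.
by rewrite -{2}[d]add0n leq_add2r leqNgt e_gt0.
Qed.

Lemma transfer_ideal_depth : is_depth (inv_deg J) (ideal_module I) l.+1.
Proof.
split; first by exists norms_head_var; apply: transfer_ideal_regular.
move=> k a rega; rewrite leqNgt; apply/negP => lt_k.
pose Y : pred R := fun r => `[< exists2 d, (0 < d)%N & inv_deg J d r >].
have degY d r : (0 < d)%N -> inv_deg J d r -> Y r.
  by move=> d_gt0 homr; apply/asboolP; exists d.
have acI := acyclic_of_regular_seq degY rega.
have acR := acyclic_of_regular_seq degY inv_ring_regular.
have [u [uN Yu]] := transfer_norms_socle; apply: uN.
apply: (@socle_obstruction _ R^o Y (fun r => r \in I) l invnorm u).
- split=> [|r r'|b r] /=; [exact: rpred0 | exact: rpredD | exact: idealMr].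
- move=> j; apply: (degY p); last exact: invnorm_homog.
  by rewrite prime_gt0 // (pcharf_prime charKp).
- by move=> i m; apply: transfer_norms_regular.
(* H^i(R) = 0 comes from the regular sequence of length l + 1 on R, and H^(i+1)(I) = 0 from the
   supposed one of length k > l + 1 on I. *)
- by move=> i le_il; apply: acyclic_quotient; [apply: acR | apply: acI; apply: leq_ltn_trans lt_k].
- by move=> y /asboolP[d d_gt0 homy]; apply: Yu homy.
Qed.

Lemma quotient_regular (i : 'I_l) (m : Q^o) :
  in_initial_submod (fun j => \pi_Q (invnorm j)) i (\pi_Q (invnorm i) *: m) ->
  in_initial_submod (fun j => \pi_Q (invnorm j)) i m.
Proof.
rewrite -[m](@reprK R Q) -[_ *: _]/(_ * _) -rmorphM.
move=> /pi_initial_submod; rewrite -/(in_transfer_norms i _).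
by move=> /transfer_norms_regular ?; apply/pi_initial_submod.
Qed.

Lemma quotient_norms_regular :
  regular_seq (quot_deg (inv_deg J) I) Q^o (fun j : 'I_l => \pi_Q (invnorm j)).
Proof.
split=> [j|]; last exact: quotient_regular.
exists p; first by rewrite prime_gt0 // (pcharf_prime charKp).
by exists (invnorm j); first exact: invnorm_homog.
Qed.

(** More than l regular elements would make H^i(R / I) vanish for all i <= l, which the socle
    element u again forbids. *)
Lemma quotient_depth : is_depth (quot_deg (inv_deg J) I) Q^o l.
Proof.
split; first by eexists; apply: quotient_norms_regular.
move=> k a rega; rewrite leqNgt; apply/negP => lt_k.
pose Y : pred Q := fun q => `[< exists2 d, (0 < d)%N & quot_deg (inv_deg J) I d q >].
have degY d q : (0 < d)%N -> quot_deg (inv_deg J) I d q -> Y q.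
  by move=> d_gt0 homq; apply/asboolP; exists d.
have acQ := acyclic_of_regular_seq degY rega.
have [u [uN Yu]] := transfer_norms_socle; apply/uN/pi_initial_submod.
have sub0 : submodule (fun m : Q^o => m = 0).
  by split=> // [v w -> ->|b v ->]; rewrite ?addr0 ?scaler0.
have [] := @socle_obstruction _ Q^o Y (fun m => m = 0) l
  (fun j : 'I_l => \pi_Q (invnorm j)) (\pi_Q u) sub0.
- by move=> j; case: quotient_norms_regular => /(_ j)[d d_gt0 homj] _; apply: degY homj.
- move=> i m [t -> ]; rewrite subr0 => /quotient_regular Im.
  by exists 0; rewrite ?subr0.
- by move=> i le_il; apply: acQ; apply: leq_ltn_trans lt_k.
- move=> y /asboolP[d d_gt0 [r homr ->]]; exists 0; rewrite // subr0.
  rewrite -[_ *: _]/(_ * _) -rmorphM; apply/pi_initial_submod.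
  exact: Yu homr.
by move=> t ->; rewrite subr0.
Qed.

End TransferDepth.

(** * Power substitutions and degree estimates *)

Section PolynomialRelations.

Variable K : fieldType.

(** Distinct monomials go to distinct monomials, so the coefficient of q at m reappears at m^e. *)
Lemma subst_pow_inj n e (q : {mpoly K[n]}) : (0 < e)%N ->
  subst (fun i => 'X_i ^+ e) q = 0 -> q = 0.
Proof.
move=> e_gt0 q0; apply/mpolyP => m; rewrite mcoeff0.
have substX_pow (m' : 'X_{1..n}) :
    subst (fun i => 'X_i ^+ e) 'X_[m'] = 'X_[(m' *+ e)%MM] :> {mpoly K[n]}.
  rewrite substXm [RHS]mpolyXE_id; apply: eq_bigr => i _.
  by rewrite -exprM mulmnE mulnC.
have pow_inj (m' : 'X_{1..n}) : ((m' *+ e)%MM == (m *+ e)%MM) = (m' == m).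
  apply/eqP/eqP => [/mnmP eq_m|-> //]; apply/mnmP => i.
  by have /eqP := eq_m i; rewrite !mulmnE eqn_pmul2r // => /eqP.
have := congr1 (mcoeff (m *+ e)%MM) q0; rewrite mcoeff0 => <-.
transitivity (\sum_(m' <- msupp q) q@_m' * (m' == m)%:R).
  rewrite [in LHS](mpolyE q) linear_sum; apply: eq_bigr => m' _.
  by rewrite /= mcoeffZ mcoeffX.
rewrite [in RHS](mpolyE q) (linear_sum (subst _)) linear_sum; apply: eq_bigr => m' _.
by rewrite /= linearZ /= substX_pow mcoeffZ mcoeffX pow_inj.
Qed.

Lemma msizeXM n (i : 'I_n) (q : {mpoly K[n]}) d :
  (msize q <= d)%N -> (msize ('X_i * q) <= d.+1)%N.
Proof.
have [->|q0] := eqVneq q 0; first by rewrite mulr0 msize0.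
by rewrite msizeM ?mpolyX_neq0 // msizeX mdeg1.
Qed.

Lemma msize_sum_le n (I : Type) (r : seq I) (P : pred I) (F : I -> {mpoly K[n]}) d :
  (forall i, P i -> msize (F i) <= d)%N -> (msize (\sum_(i <- r | P i) F i) <= d)%N.
Proof.
move=> le_F; apply: (leq_trans (msize_sum _ _ _)).
by elim/big_rec: _ => // i e Pi le_e; rewrite geq_max le_F.
Qed.

End PolynomialRelations.

(** * Generation and independence over the norms *)

Section Generation.

Variables (K : fieldType) (p : nat) (charKp : p \in [pchar K]).
Variables (gT : finGroupType) (sigma : gT).
Hypotheses (gen_sigma : [set: gT] = <[sigma]>%g) (card_gT : #|gT| = p).
Variables (l : nat) (n : 'I_l -> nat) (n_gt1 : forall j, (1 < n j)%N).
Variable J : jordan_action K n sigma.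

Notation S := {mpoly K[num_vars n]}.
Notation R := (inv_ring J).
Notation I := (transfer_ideal J charKp : idealr R).
Notation Q := {ideal_quot I}.
Notation N := (invnorm n_gt1 J).

Let p_gt0 : (0 < p)%N := prime_gt0 (pcharf_prime charKp).

Definition norm_eval : {mpoly K[l]} -> R := mmap (in_alg R) N.

HB.instance Definition _ := GRing.RMorphism.on norm_eval.

Lemma norm_evalX j : norm_eval 'X_j = N j.
Proof. by rewrite /norm_eval mmapX mmap1U. Qed.

Lemma norm_evalC c : norm_eval c%:MP = c%:A.
Proof. exact: mmapC. Qed.

Lemma inv_val_norm_eval q : inv_val (norm_eval q) = subst (nrm n_gt1 J) q.
Proof.
apply: (mpoly_rmorph_ext (f := (\val : R -> S) \o norm_eval)
                         (g := subst (nrm n_gt1 J))) => [c|j] /=.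
  by rewrite norm_evalC substC -alg_mpolyC.
by rewrite norm_evalX substX.
Qed.

Lemma quotient_eval q :
  mmap (in_alg Q) (fun j => \pi_Q (N j)) q = \pi_Q (norm_eval q).
Proof.
apply: (mpoly_rmorph_ext (f := mmap (in_alg Q) (fun j => \pi_Q (N j)))
                         (g := \pi_Q \o norm_eval)) => [c|j] /=.
  by rewrite mmapC norm_evalC -[RHS]mulr1.
by rewrite mmapX mmap1U norm_evalX.
Qed.

(* Restriction to the fixed space V^G, on which only the variables
   x_(n_j, j) survive. *)
Definition fixed_res : S -> {mpoly K[l]} :=
  subst (fun k => if k == top n_gt1 (blk k) then 'X_(blk k) else 0).

HB.instance Definition _ := GRing.Linear.on fixed_res.
HB.instance Definition _ := GRing.RMorphism.on fixed_res.

Lemma fixed_res_top j : fixed_res 'X_(top n_gt1 j) = 'X_j.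
Proof. by rewrite /fixed_res substX blk_top eqxx. Qed.

Lemma fixed_res_act f : fixed_res (J sigma f) = fixed_res f.
Proof.
apply: (mpoly_rmorph_ext (f := fixed_res \o J sigma) (g := fixed_res)) => [c|k] /=.
  by rewrite lrmorphC alg_mpolyC.
have [->//|[k' [blk_k' pos_k ->]]] := act_cases J k.
rewrite raddfD /= [X in _ + X]substX (negbTE (act_ntop n_gt1 blk_k' pos_k _)).
by rewrite addr0.
Qed.

Lemma fixed_res_power g f : fixed_res (J g f) = fixed_res f.
Proof.
have [i ->] := act_power gen_sigma J g.
by elim: i => //= i <-; apply: fixed_res_act.
Qed.

Lemma fixed_res_transfer f : fixed_res (transfer p J f) = 0.
Proof.
rewrite /transfer raddf_sum (eq_bigr (fun=> fixed_res f)) => [|i _] /=.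
  rewrite sumr_const card_ord -mulr_natl -mpolyC_nat (pcharf0 charKp).
  by rewrite mpolyC0 mul0r.
by rewrite iter_act fixed_res_power.
Qed.

Lemma fixed_res_nrm j : fixed_res (nrm n_gt1 J j) = 'X_j ^+ p.
Proof.
rewrite /nrm /norm_poly rmorph_prod -card_gT -prodr_const.
rewrite [RHS](eq_bigl xpredT); last by move=> g; rewrite inE.
by apply: eq_bigr => g _ /=; rewrite fixed_res_power fixed_res_top.
Qed.

Lemma fixed_res_norm_eval q :
  fixed_res (inv_val (norm_eval q)) = subst (fun j => 'X_j ^+ p) q.
Proof.
rewrite inv_val_norm_eval.
apply: (mpoly_rmorph_ext (f := fixed_res \o subst (nrm n_gt1 J))
   (g := subst (fun j => 'X_j ^+ p))) => [c|j] /=; last by rewrite !substX fixed_res_nrm.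
by rewrite /fixed_res !substC.
Qed.

Lemma fixed_res_transfer_ideal r : r \in I -> fixed_res (inv_val r) = 0.
Proof. by move=> /transfer_idealP[f <-]; apply: fixed_res_transfer. Qed.

Lemma quotient_norms_independent :
  algebraically_independent (fun j => \pi_Q (N j)).
Proof.
move=> q; rewrite quotient_eval => /pi_eq0/fixed_res_transfer_ideal.
by rewrite fixed_res_norm_eval; apply: subst_pow_inj.
Qed.

(** Polynomials of bounded degree are encoded as row vectors of coefficients, among which the
    invariants form a subspace. *)
Lemma invariants_spanned D : exists m (b : 'I_m -> R), forall r : R,
  (msize (inv_val r) <= D)%N -> exists w : 'I_m -> K, r = \sum_i w i *: b i.
Proof.
pose T : finType := bmultinom (num_vars n) D.
pose poly_of (u : 'rV[K]_#|T|) : S := \sum_i u 0 i *: 'X_[enum_val i].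
have poly_ofP (f : S) : (msize f <= D)%N -> exists u, f = poly_of u.
  move=> le_f; exists (\row_(i < #|T|) f@_(enum_val i : T)).
  rewrite [LHS](mpolywE le_f) (reindex (@enum_val T T)) /=; last first.
    exact/onW_bij/enum_val_bij.
  by apply: eq_bigr => i _; rewrite mxE.
have poly_ofD c u v : poly_of (c *: u + v) = c *: poly_of u + poly_of v.
  rewrite /poly_of scaler_sumr -big_split; apply: eq_bigr => i _ /=.
  by rewrite !mxE scalerDl scalerA.
have poly_of0 : poly_of 0 = 0.
  by rewrite /poly_of big1 // => i _; rewrite mxE scale0r.
pose P u := exists r : R, inv_val r = poly_of u.
have [||m [A [rowA spanA]]] := @subspace_spanned _ _ P.
- by exists 0; rewrite poly_of0.
- by move=> c u v [r def_r] [r' def_r']; exists (c *: r + r'); rewrite poly_ofD -def_r -def_r'.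
have [b def_b] := fin_all_exists rowA.
exists m, b => r le_r; have [u def_r] := poly_ofP _ le_r.
have [|w def_u] := submxP (spanA u _); first by exists r.
exists (fun i => w 0 i); apply: inv_val_inj.
have poly_of_sum (E : finType) (F : E -> 'rV_#|T|) (a : E -> K) :
    poly_of (\sum_i a i *: F i) = \sum_i a i *: poly_of (F i).
  by elim/big_rec2: _ => // i x y _ <-; apply: poly_ofD.
rewrite def_r def_u mulmx_sum_row poly_of_sum inv_val_sum.
by apply: eq_bigr => i _; rewrite -def_b.
Qed.

(** The generators span the invariants of degree at most l p. A homogeneous invariant of larger
    degree is, modulo I, a combination of norms with cofactors of degree lower by p, to which
    induction applies. The degree bound on the coefficients serves the later monomial count. *)
Lemma inv_ring_generated : exists m (b : 'I_m -> R), forall d (r : R),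
    (msize (inv_val r) <= d.+1)%N ->
  exists c : 'I_m -> {mpoly K[l]}, (forall i, msize (c i) <= d.+1)%N /\
    r - \sum_i norm_eval (c i) * b i \in I.
Proof.
have [m [b spanb]] := invariants_spanned (l * p).+1; exists m, b.
have homog_case d (r : R) : inv_deg J d r ->
    exists c : 'I_m -> {mpoly K[l]}, (forall i, msize (c i) <= d.+1)%N /\
      r - \sum_i norm_eval (c i) * b i \in I.
  elim/ltn_ind: d r => d IHd r homr; have [le_d|lt_d] := leqP d (l * p).
    have [|w def_r] := spanb r.
      rewrite msizeE; apply/bigmax_leqP_seq => k k_r _.
      by rewrite (dhomog_mf homr k_r) ltnS.
    exists (fun i => (w i)%:MP); split=> [i|].
      by rewrite msizeC; case: (w i != 0).
    rewrite {1}def_r -sumrB big1 ?rpred0 // => i _.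
    by rewrite norm_evalC -scalerAl mul1r subrr.
  have [h [homh rI]] := high_degree_transfer_norms charKp gen_sigma card_gT n_gt1 homr lt_d.
  have [c cP] : exists c : 'I_l -> 'I_m -> {mpoly K[l]}, forall j,
      (forall i, msize (c j i) <= d)%N /\
      h j - \sum_i norm_eval (c j i) * b i \in I.
    apply: (fin_all_exists (P := fun j c => (forall i, msize (c i) <= d)%N /\
      h j - \sum_i norm_eval (c i) * b i \in I)) => j.
    have lt_dp : (d - p < d)%N by rewrite ltn_subrL p_gt0 (leq_ltn_trans _ lt_d).
    have [c [le_c cI]] := IHd _ lt_dp _ (homh j); exists c; split=> // i.
    exact: leq_trans (le_c i) lt_dp.
  exists (fun i => \sum_j 'X_j * c j i); split=> [i|].
    by apply: msize_sum_le => j _; apply: msizeXM; case: (cP j).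
  have -> : \sum_i norm_eval (\sum_j 'X_j * c j i) * b i =
      \sum_j N j * \sum_i norm_eval (c j i) * b i.
    under eq_bigr do rewrite rmorph_sum mulr_suml.
    rewrite exchange_big; apply: eq_bigr => j _; rewrite mulr_sumr.
    by apply: eq_bigr => i _ /=; rewrite rmorphM /= norm_evalX mulrA.
  have -> : r - \sum_j N j * \sum_i norm_eval (c j i) * b i =
      r - \sum_j N j * h j + \sum_j N j * (h j - \sum_i norm_eval (c j i) * b i).
    under [X in _ = _ + X]eq_bigr do rewrite mulrBr.
    by rewrite sumrB addrA subrK.
  by apply: rpredD => //; apply: rpred_sum => j _; apply: idealMr; case: (cP j).
move=> d r le_r.
have inv_pihomog e : pihomog mdeg e (inv_val r) \in Defs.invariant J.
  apply: (invariant_act gen_sigma); apply: act_pihomog (act_inv_val r) => k k' _ /=.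
  by rewrite !mdeg1.
have def_r : r = \sum_(e < d.+1) InvRing (inv_pihomog e).
  by apply: inv_val_inj; rewrite inv_val_sum /=; apply: pihomog_partitionE.
have [c cP] : exists c : 'I_d.+1 -> 'I_m -> {mpoly K[l]}, forall e,
    (forall i, msize (c e i) <= d.+1)%N /\
    InvRing (inv_pihomog e) - \sum_i norm_eval (c e i) * b i \in I.
  apply: (fin_all_exists (P := fun (e : 'I_d.+1) c => (forall i, msize (c i) <= d.+1)%N /\
      InvRing (inv_pihomog e) - \sum_i norm_eval (c i) * b i \in I)) => e.
  have [|c [le_c cI]] := homog_case e (InvRing (inv_pihomog e)); first exact: pihomogP.
  by exists c; split=> // i; apply: leq_trans (le_c i) _.
exists (fun i => \sum_e c e i); split=> [i|].
  by apply: msize_sum_le => e _; case: (cP e).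
have -> : r - \sum_i norm_eval (\sum_e c e i) * b i =
    \sum_e (InvRing (inv_pihomog (e : 'I_d.+1)) - \sum_i norm_eval (c e i) * b i).
  rewrite sumrB -def_r; congr (_ - _); rewrite exchange_big.
  by apply: eq_bigr => i _ /=; rewrite rmorph_sum mulr_suml.
by apply: rpred_sum => e _; case: (cP e).
Qed.

Lemma quotient_hsop : hsop (quot_deg (inv_deg J) I) (fun j => \pi_Q (N j)).
Proof.
split=> [j||]; last 1 first.
- have [m [b genb]] := inv_ring_generated; exists m, (fun i => \pi_Q (b i)) => q.
  have [c [_ cI]] := genb _ (generic_quotient.repr q) (leqnSn _).
  exists c; rewrite -[LHS]reprK; move/pi_eq: cI => ->.
  by rewrite rmorph_sum; apply: eq_bigr => i _; rewrite quotient_eval -rmorphM.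
- by exists p, (N j); first exact: invnorm_homog.
- exact: quotient_norms_independent.
Qed.

End Generation.

(** * Degree bounds and counting of monomials *)

Section Sizes.

Variables (K : fieldType) (n : nat).

Lemma msizeM_leq (f g : {mpoly K[n]}) : (msize (f * g) <= msize f + msize g)%N.
Proof.
have [->|f0] := eqVneq f 0; first by rewrite mul0r msize0.
have [->|g0] := eqVneq g 0; first by rewrite mulr0 msize0.
by rewrite msizeM // leq_pred.
Qed.

Lemma msize_prodX_leq (I : finType) (f : I -> {mpoly K[n]}) (mu : I -> nat) C e :
    (forall i, msize (f i) <= C)%N -> (forall i, mu i <= e)%N ->
  (msize (\prod_i f i ^+ mu i) <= (#|I| * (e * C).+1).+1)%N.
Proof.
move=> le_f le_mu; rewrite -sum_nat_const.
apply: (big_ind2 (fun u d => msize u <= d.+1)%N); first by rewrite msize1.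
  move=> u d v d' le_u le_v; have [->|u0] := eqVneq u 0; first by rewrite mul0r msize0.
  have [->|v0] := eqVneq v 0; first by rewrite mulr0 msize0.
  rewrite msizeM // (mpolySpred _ u0) addSn /= -addnS.
  by apply: leq_add; rewrite // -ltnS -mpolySpred.
move=> i _; apply: leqW; rewrite -addn1; apply: (@leq_trans (mu i * C).+1); last first.
  by rewrite addn1 ltnS leq_mul2r le_mu orbT.
elim: (mu i) => [|k IHk]; first by rewrite expr0 msize1.
rewrite exprS mulSn -addnS (leq_trans (msizeM_leq _ _)) //.
exact: leq_add.
Qed.

Lemma card_bmultinom_leq D : (#|{: bmultinom n D.+1}| <= D.+1 ^ n)%N.
Proof.
have <- : #|{ffun 'I_n -> 'I_D.+1}| = (D.+1 ^ n)%N by rewrite card_ffun !card_ord.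
pose f (m : bmultinom n D.+1) : {ffun 'I_n -> 'I_D.+1} := [ffun i => inord (m i)].
apply: (@leq_card _ _ f) => m m' /ffunP eq_f.
have lt_mi (m0 : bmultinom n D.+1) i : (m0 i < D.+1)%N.
  by apply: leq_ltn_trans (bmdeg m0); rewrite mdegE (bigD1 i) //= leq_addr.
apply/val_inj/mnmP => i; have := eq_f i; rewrite !ffunE.
by move/(congr1 val); rewrite /= !inordK.
Qed.

End Sizes.

(** * Krull dimension of the quotient *)

Section KrullDimension.

Variables (K : fieldType) (p : nat) (charKp : p \in [pchar K]).
Variables (gT : finGroupType) (sigma : gT).
Hypotheses (gen_sigma : [set: gT] = <[sigma]>%g) (card_gT : #|gT| = p).
Variables (l : nat) (n : 'I_l -> nat) (n_gt1 : forall j, (1 < n j)%N).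
Variable J : jordan_action K n sigma.

Notation S := {mpoly K[num_vars n]}.
Notation R := (inv_ring J).
Notation I := (transfer_ideal J charKp : idealr R).
Notation N := (invnorm n_gt1 J).

(** There are e^(l+1) monomials in y with exponents below e. Modulo I they are described by m
    polynomials in l variables of degree O(e), so by O(e^l) coefficients; for large e they are
    linearly dependent. *)
Lemma algebraic_relation (y : 'I_l.+1 -> R) :
  exists e (c : {ffun 'I_l.+1 -> 'I_e} -> K), (exists t, c t != 0) /\
    \sum_t c t *: \prod_i y i ^+ (t i : 'I_e) \in I.
Proof.
have [m [b genb]] := inv_ring_generated charKp gen_sigma card_gT n_gt1 J.
pose C := (\max_i msize (inv_val (y i)))%N.
(* With [d] as defined next, d + 1 <= B e, so there are at most m (B e)^l coefficients; this is less
   than e^(l+1) because m B^l < e. *)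
pose B := (l.+1 * C.+1).+1; pose e := (m * B ^ l).+1.
pose d := (l.+1 * (e * C).+1)%N.
pose T : finType := {ffun 'I_l.+1 -> 'I_e}.
pose w (t : T) : R := \prod_i y i ^+ (t i : 'I_e).
have inv_val_w t : inv_val (w t) = \prod_i inv_val (y i) ^+ (t i : 'I_e).
  rewrite [LHS](rmorph_prod (\val : R -> S)); apply: eq_bigr => i _.
  exact: (rmorphXn (\val : R -> S)).
have [a aP] : exists a : T -> 'I_m -> {mpoly K[l]}, forall t,
    (forall i, msize (a t i) <= d.+1)%N /\ w t - \sum_i norm_eval n_gt1 J (a t i) * b i \in I.
  apply: (fin_all_exists (P := fun (t : T) a => (forall i, msize (a i) <= d.+1)%N /\
    w t - \sum_i norm_eval n_gt1 J (a i) * b i \in I)) => t; apply: genb; rewrite inv_val_w.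
  have -> : d = (#|'I_l.+1| * (e * C).+1)%N by rewrite card_ord.
  apply: msize_prodX_leq => i; first exact: (leq_bigmax i).
  by rewrite ltnW.
pose U : finType := ('I_m * bmultinom l d.+1)%type.
pose A : 'M[K]_(#|T|, #|U|) :=
  \matrix_(t < #|T|, u < #|U|)
     (a (enum_val t : T) (enum_val u : U).1)@_((enum_val u : U).2 : bmultinom _ _).
have lt_UT : (#|U| < #|T|)%N.
  rewrite card_prod card_ord card_ffun !card_ord.
  apply: (@leq_ltn_trans (m * (B * e) ^ l)%N).
    rewrite leq_mul2l (leq_trans (card_bmultinom_leq _ _)) ?orbT //.
    have le_dB : (d.+1 <= B * e)%N.
      rewrite /B mulSn -add1n leq_add // /d -mulnA leq_mul2l /= mulSn [(C * e)%N]mulnC.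
      by rewrite -add1n leq_add2r.
    have le_pow k : (d.+1 ^ k <= (B * e) ^ k)%N.
      by elim: k => // k IHk; rewrite !expnS leq_mul.
    exact: le_pow.
  by rewrite expnMn mulnA expnS ltn_mul2r expn_gt0 /= ltnSn.
have [u u0 uA] := nontrivial_relation A lt_UT.
pose c (t : T) := u 0 (enum_rank t); exists e, c; split.
  have /rV0Pn[t ut] := u0; exists (enum_val t).
  by rewrite /c enum_valK.
have Z0 i : \sum_t c t *: a t i = 0.
  apply/mpolyP => k; rewrite mcoeff0 raddf_sum /=.
  under eq_bigr do rewrite mcoeffZ.
  have [lt_k|le_k] := ltnP (mdeg k) d.+1.
    have := congr1 (fun v : 'rV_#|U| => v 0 (enum_rank (i, BMultinom lt_k))) uA.
    rewrite !mxE => uA0; rewrite -[RHS]uA0 (reindex (@enum_val T T)) /=; last first.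
      exact/onW_bij/enum_val_bij.
    by apply: eq_bigr => t _; rewrite /c enum_valK !mxE enum_rankK.
  apply: big1 => t _; rewrite memN_msupp_eq0 ?mulr0 //.
  by apply: msize_mdeg_ge; apply: leq_trans le_k; case: (aP t).
have -> : \sum_t c t *: w t =
    \sum_t (c t)%:A * (w t - \sum_i norm_eval n_gt1 J (a t i) * b i).
  under [RHS]eq_bigr do rewrite mulrBr; rewrite sumrB.
  rewrite [X in _ = _ - X](_ : _ = 0) ?subr0.
    by apply: eq_bigr => t _; rewrite -scalerAl mul1r.
  under eq_bigr do rewrite mulr_sumr; rewrite exchange_big big1 // => i _.
  have := congr1 (fun q => norm_eval n_gt1 J q * b i) (Z0 i).
  rewrite raddf0 mul0r raddf_sum mulr_suml => evZ0; rewrite -[RHS]evZ0.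
  apply: eq_bigr => t _ /=.
  by rewrite -mul_mpolyC rmorphM /= norm_evalC mulrA.
by apply: rpred_sum => t _; apply: idealMr; case: (aP t).
Qed.

(** * Chains of primes in a ring identified with R / I *)

Section Quotient.

Variables (E : comNzRingType) (f : {rmorphism R -> E}).
Hypothesis f_surj : forall x, exists r, x = f r.
Hypothesis f_ker : forall r, f r = 0 <-> r \in I.

Let res i (r : R) := kill (fun j : 'I_l => (j < i)%N) (fixed_res n_gt1 (inv_val r)).

(** The preimage of the prime (z_1, ..., z_i) of K[V^G], described through representatives in R
    because restriction is defined there. *)
Definition fixed_prime (i : nat) : {pred E} :=
  fun x => `[< exists2 r, x = f r & res i r = 0 >].

Let resB i r r' : res i (r - r') = res i r - res i r'.
Proof. by rewrite /res inv_valB !raddfB. Qed.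

Let resD i r r' : res i (r + r') = res i r + res i r'.
Proof. by rewrite /res inv_valD !raddfD. Qed.

Let resM i r r' : res i (r * r') = res i r * res i r'.
Proof. by rewrite /res inv_valM !rmorphM. Qed.

(** Independence of the representative: restriction to V^G kills I. *)
Lemma mem_fixed_prime i r : (f r \in fixed_prime i) = (res i r == 0).
Proof.
apply/asboolP/eqP => [[r' /eqP]|r0]; last by exists r.
rewrite -subr_eq0 -rmorphB => /eqP/f_ker/(fixed_res_transfer_ideal gen_sigma n_gt1) r0 r'0.
by rewrite -[LHS]subr0 -r'0 -resB /res r0 raddf0.
Qed.

Lemma fixed_prime_prime i : prime_ideal (fixed_prime i).
Proof.
split=> [|x y].
  split=> [||x u v].
  - by rewrite -(rmorph0 f) mem_fixed_prime /res !raddf0.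
  - by rewrite -(rmorph1 f) mem_fixed_prime /res !rmorph1 oner_eq0.
  have [r ->] := f_surj x; have [r1 ->] := f_surj u; have [r2 ->] := f_surj v.
  rewrite -rmorphM -rmorphD !mem_fixed_prime resD resM => /eqP-> /eqP->.
  by rewrite mulr0 addr0.
have [r ->] := f_surj x; have [r' ->] := f_surj y.
by rewrite -rmorphM !mem_fixed_prime resM mulf_eq0.
Qed.

Lemma transfer_quotient_krull_dim : is_krull_dim E l.
Proof.
split.
  exists (fun i : 'I_l.+1 => fixed_prime i); split=> [i|i j lt_ij].
    exact: fixed_prime_prime.
  split=> [x|sub_ji].
    have [r ->] := f_surj x; rewrite !mem_fixed_prime => /eqP r0.
    have := congr1 (kill (fun j0 : 'I_l => (j0 < j)%N)) r0.
    rewrite raddf0 /res kill_kill => <-; apply/eqP/eq_kill => k /=.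
    by apply/esym/orb_idr => lt_ki; apply: ltn_trans lt_ij.
  have lt_il : (i < l)%N by apply: leq_trans lt_ij _; rewrite -ltnS.
  have p_gt0 : (0 < p)%N by rewrite prime_gt0 // (pcharf_prime charKp).
  (* This norm restricts to z_(i+1)^p, which vanishes modulo (z_1, ..., z_j) but not modulo (z_1,
     ..., z_i). *)
  have Pj : f (N (Ordinal lt_il)) \in fixed_prime j.
    rewrite mem_fixed_prime /res inv_val_invnorm (fixed_res_nrm gen_sigma card_gT).
    by rewrite rmorphXn /= killX lt_ij expr0n eqn0Ngt p_gt0.
  have := sub_ji _ Pj.
  rewrite mem_fixed_prime /res inv_val_invnorm (fixed_res_nrm gen_sigma card_gT).
  by rewrite rmorphXn /= killX ltnn expf_eq0 (negbTE (mpolyX_neq0 _ _)) andbF.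
move=> e P [primeP chainP]; rewrite leqNgt; apply/negP => lt_le.
(* Only the first l + 2 primes of the chain are used; their indices are at most l + 1 <= e, so
   [inord] preserves them. *)
have lt_inord (i : 'I_l.+1) : ((inord i : 'I_e.+1) < (inord i.+1 : 'I_e.+1))%N.
  have lt_i1 : (i.+1 < e.+1)%N by rewrite ltnS (leq_trans (ltn_ord i)).
  by rewrite !inordK // ltnW.
pose P' i : {pred R} := fun r => f r \in P (inord i).
have [y yP] : exists y : 'I_l.+1 -> R, forall i : 'I_l.+1,
    y i \in P' i.+1 /\ y i \notin P' i.
  apply: (fin_all_exists (P := fun (i : 'I_l.+1) r => r \in P' i.+1 /\ r \notin P' i)) => i.
  have [_ nsub] := chainP _ _ (lt_inord i); apply: contrapT => nex; apply: nsub => x Px.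
  have [r def_x] := f_surj x; apply/negPn/negP => nPx; apply: nex; exists r.
  by rewrite /P' !unfold_in -def_x.
have [e' [c [[t ct] relI]]] := algebraic_relation y.
have := @prime_chain_free K R l.+1 P' y _ (fun (t : {ffun 'I_l.+1 -> 'I_e'}) i => t i) c.
move=> free; move/eqP: ct; apply; apply: free => [i le_i|i r|i|t1 t2 eq_t|].
- have [[P0 P1 Plin] Pprime] := primeP (inord i); split=> [|r r'].
    split=> [||r u v uP vP]; rewrite /in_mem /= /P' ?rmorph0 ?rmorph1 //.
    by rewrite rmorphD rmorphM; apply: Plin.
  by rewrite /in_mem /= /P' rmorphM; apply: Pprime.
- by have [sub _] := chainP _ _ (lt_inord i); apply: sub.
- exact: yP.
- by apply/ffunP => i; apply/val_inj/eq_t.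
- have [[P0 _ _] _] := primeP (inord 0).
  by rewrite /in_mem /= /P'; move/f_ker: relI => ->.
Qed.

End Quotient.

(** R / I has zero annihilator over itself, as testing on 1 shows, so the composite projection from
    R still has kernel I. *)
Lemma quotient_module_dim : is_module_dim ({ideal_quot I}^o) l.
Proof.
have Q_neq0 : exists m : {ideal_quot I}^o, m != 0 by exists 1; rewrite oner_neq0.
exists Q_neq0.
pose f := \pi_{ideal_quot (annihilator Q_neq0)} \o \pi_{ideal_quot I} : R -> _.
apply: (@transfer_quotient_krull_dim _ f) => [x|r].
  exists (generic_quotient.repr (generic_quotient.repr x)).
  by rewrite /f /= !reprK.
rewrite /f /=; split=> [/pi_eq0|/pi_eq0 r0].
  move/asboolP/(_ (1 : {ideal_quot I})) => r1; apply/pi_eq0.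
  by rewrite -[LHS]mulr1.
by apply/pi_eq0/asboolP => m; rewrite r0 scale0r.
Qed.

End KrullDimension.

Theorem theorem11 (K : closedFieldType) (p : nat) (charKp : p \in [pchar K])
    (gT : finGroupType) (sigma : gT)
    (gen_sigma : [set: gT] = <[sigma]>%g) (card_gT : #|gT| = p)
    (l : nat) (l_gt0 : (0 < l)%N) (n : 'I_l -> nat)
    (n_gt1 : forall j, (1 < n j)%N) (n_le_p : forall j, (n j <= p)%N)
    (J : jordan_action K n sigma) :
  let I : idealr (inv_ring J) := transfer_ideal J charKp in
  [/\ cohen_macaulay (quot_deg (inv_deg J) I),
      hsop (quot_deg (inv_deg J) I)
        (fun j : 'I_l =>
           \pi_{ideal_quot I} (norm J (xvar K (last_ord (n_gt1 j)))))
    & is_depth (inv_deg J) (ideal_module I) l.+1].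
Proof.
move=> I; split.
- exists l; split; first exact: (quotient_depth charKp gen_sigma card_gT n_gt1).
  exact: (quotient_module_dim charKp gen_sigma card_gT n_gt1).
- exact: (quotient_hsop charKp gen_sigma card_gT n_gt1).
- exact: (transfer_ideal_depth charKp gen_sigma card_gT l_gt0 n_gt1).
Qed.
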